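(* Let $T>0$ and $g:\mathbb{R}^n\to\mathbb{R}$, and let $\mu_{g,T}=\mathbb{E}[g(\bm{X}(T))]$, where $\bm{X}$ is the solution of the jump SDE system $d\bm{X}(t)=\bm{c}(\bm{X}(t^-))\,d\bm{J}(t)$ described in the context. Let $u_T(h,L)$ be the sample approximation of $\mu_{g,T}$ generated by the antithetic sampling algorithm described in the context, using a numerical scheme (the Euler scheme or the Taylor scheme of the context) of weak order $\beta>0$. Suppose that $g\in C_P^{2\beta+2}(\mathbb{R}^n;\mathbb{R})$ and that 1. there exist $C>0$ and a positive integer $s$ such that $g(\bm{x})\le C(1+\|\bm{x}\|^s)$ for all $\bm{x}\in\mathbb{R}^n$; 2. $\mathbb{E}[g^2(\bm{X}(T))]<\infty$. Let $C_{g,T}>0$ be a constant, independent of $h$, for which the weak order bound $|\mathbb{E}[g(\bm{X}^h(T))]-\mathbb{E}[g(\bm{X}(T))]|\le C_{g,T}h^\beta$ holds. Then there exists a constant $\sigma_{g,T}^2$, dependent on $g$ and $T$ but not on $h$ and $\beta$, such that for all admissible $h$ and $L$ (as specified in the context) the root mean squared error $e_T(h,L)=\big\{\mathbb{E}\big[|u_T(h,L)-\mu_{g,T}|^2\big]\big\}^{1/2}$ satisfies $$e_T(h,L)\le\Big(\frac{\sigma_{g,T}^2}{L}+C_{g,T}^2h^{2\beta}\Big)^{1/2}.$$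
   Context: **Network.** $\mathcal{G}=(\mathcal{V},\mathcal{E})$ is a fixed directed graph with $\mathcal{V}=\{1,\dots,n\}$, $\mathcal{E}\subset\mathcal{V}\times\mathcal{V}$, $m=|\mathcal{E}|$. Each edge $(i,j)\in\mathcal{E}$ carries an activation rate $\alpha_{ij}>0$ and each node $i$ a recovery rate $\gamma_i>0$ (in the model without recovery, $\gamma_i=0$ and the recovery terms vanish). Let $\mathcal{V}_j^+=\{i:(i,j)\in\mathcal{E}\}$, with elements listed as $k_1<k_2<\dots$. **Jump SDE.** $N_{ij}(t)$, $(i,j)\in\mathcal{E}$, and $R_i(t)$, $i\in\mathcal{V}$, are independent homogeneous Poisson processes with intensities $\alpha_{ij}$ and $\gamma_i$, respectively, starting at $0$. Put $\bm{R}(t)=(R_1(t),\dots,R_n(t))^\top$, $\bm{N}_{\cdot j}(t)=(N_{k_1j}(t),N_{k_2j}(t),\dots)^\top\in\mathbb{R}^{|\mathcal{V}_j^+|}$, $\bm{N}(t)=(\bm{N}_{\cdot1}(t)^\top,\dots,\bm{N}_{\cdot n}(t)^\top)^\top\in\mathbb{R}^m$, $\bm{J}(t)=(\bm{R}(t)^\top,\bm{N}(t)^\top)^\top\in\mathbb{R}^{n+m}$. For $\bm{X}=(X_1,\dots,X_n)^\top\in\mathbb{R}^n$ let $\bm{c}_0(\bm{X})=\mathrm{diag}(X_1,\dots,X_n)$, $\bm{b}_j(\bm{X})=((1-X_j)X_{k_1},(1-X_j)X_{k_2},\dots)^\top\in\mathbb{R}^{|\mathcal{V}_j^+|}$, let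 $\bm{c}_1(\bm{X})\in\mathbb{R}^{n\times m}$ be the block-diagonal matrix with $(j,j)$-block the row vector $\bm{b}_j(\bm{X})^\top$, and $\bm{c}(\bm{X})=[-\bm{c}_0(\bm{X}),\bm{c}_1(\bm{X})]\in\mathbb{R}^{n\times(n+m)}$. The process $\bm{X}(t)$ is the right-continuous solution with left limits of $d\bm{X}(t)=\bm{c}(\bm{X}(t^-))\,d\bm{J}(t)$, i.e. $dX_j(t)=(1-X_j(t^-))\sum_{i\in\mathcal{V}_j^+}X_i(t^-)\,dN_{ij}(t)-X_j(t^-)\,dR_j(t)$, with deterministic initial value $X_i(0)=1$ if $i$ is a source node (in a fixed source set) and $X_i(0)=0$ otherwise. **Schemes.** For a step size $h$ with $T/h$ an integer, let $t_k=kh$, $\bm{X}^h_0=\bm{X}(0)$, $\bm{X}^h_k=\bm{X}^h(t_k)$ and $\Delta\bm{J}_k=\bm{J}(t_{k+1})-\bm{J}(t_k)$ (independent Poisson entries with means $\gamma_ih$ and $\alpha_{ij}h$). The Euler scheme is $\bm{X}^h_{k+1}=\bm{X}^h_k+\bm{c}(\bm{X}^h_k)\Delta\bm{J}_k$. The Taylor scheme is $\bm{X}^h_{k+.5}=\bm{X}^h_k+\bm{c}_k\Delta\bm{J}_k$, $\bm{X}^h_{k+1}=\bm{X}^h_k+\bm{c}_k\Delta\bm{J}_k+\tfrac12(\bm{c}_{k+.5}-\bm{c}_k)\,\Delta\bm{J}_k(\Delta\bm{J}_k-1)$, where $\bm{c}_k=\bm{c}(\bm{X}^h_k)$, $\bm{c}_{k+.5}=\bm{c}(\bm{X}^h_{k+.5})$,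 and the subtraction and product in $\Delta\bm{J}_k(\Delta\bm{J}_k-1)$ are componentwise. **Weak order.** $C_P^{r}(\mathbb{R}^n;\mathbb{R})$ is the space of $r$ times continuously differentiable functions with partial derivatives of polynomial growth. A scheme has weak order $\beta>0$ if for any $g\in C_P^{2\beta+2}(\mathbb{R}^n;\mathbb{R})$ there is a constant $C_{g,T}>0$ independent of $h$ such that $|\mathbb{E}[g(\bm{X}^h(T))]-\mathbb{E}[g(\bm{X}(T))]|\le C_{g,T}h^\beta$ for all sufficiently small $h>0$. **Algorithm.** Let $L$ be even, $K=T/h$, and $\bm{t}_k=[kh,(k+1)h)$ for $k=0,\dots,K-1$. For each $l=1,\dots,L/2$, independently: for each node $i$ (resp. each edge $(i,j)$), independently, let $F$ be the cumulative distribution function of the Poisson distribution with mean $\gamma_iT$ (resp. $\alpha_{ij}T$), draw $U\sim\mathrm{Uniform}(0,1)$, set $Z^+=F^{-1}(1-U)$ and $Z^-=F^{-1}(U)$ ($F^{-1}$ is the generalized inverse), and sample $Z^+$ points and $Z^-$ points independently and uniformly on $[0,T]$; the $Z^+$ points are used for trajectory $\ell=l$ and the $Z^-$ points for trajectory $\ell=L/2+l$. The increments $(\Delta\bm{R}_k^\ell)_i$ (resp. $(\Delta\bm{N}_k^\ell)_{ij}$) are the numbers of the corresponding points lying in $\bm{t}_k$. Running the chosen scheme with these increments as $\Delta\bm{J}_k$ yields $\bm{X}^{h,\ell}(T)$ for $\ell=l$ and $\ell=L/2+l$. The output is $u_T(h,L)=\frac1L\sum_{\ell=1}^{L}g(\bm{X}^{h,\ell}(T))$.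 **Admissible $h$, $L$.** $L$ is an even positive integer, and $h\in(0,1)$ is such that $T/h$ is an integer and the weak order bound with constant $C_{g,T}$ holds for this $h$. *)

(* Defs.v *)
From HB Require Import structures.
From mathcomp Require Import all_boot all_order all_algebra.
From mathcomp Require Import all_classical all_reals all_analysis.

Set Implicit Arguments.
Unset Strict Implicit.
Unset Printing Implicit Defensive.

Import Order.TTheory GRing.Theory Num.Theory.
Import numFieldNormedType.Exports.

Local Open Scope classical_set_scope.
Local Open Scope ring_scope.

(* The second disjunct of [recovery_sign] is the model without recovery. *)
Record network (R : realType) (n : nat) := Network {
  edge : {set 'I_n * 'I_n};
  activation : 'I_n -> 'I_n -> R;
  recovery : 'I_n -> R;
  source : {set 'I_n};
  activation_gt0 : forall i j, (i, j) \in edge -> 0 < activation i j;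
  recovery_sign : (forall i, 0 < recovery i) \/ (forall i, recovery i = 0) }.

(* The n + m coordinates of J = (R, N) are indexed by this finite type rather
   than by 'I_(n + m): [inl i] is R_i and [inr (i, j)] is N_ij. *)
Definition channel (R : realType) n (G : network R n) : finType :=
  ('I_n + {e : 'I_n * 'I_n | e \in edge G})%type.

Definition rate (R : realType) n (G : network R n) (a : channel G) : R :=
  match a with
  | inl i => recovery G i
  | inr e => activation G (val e).1 (val e).2
  end.

Definition x_init (R : realType) n (G : network R n) : 'cV[R]_n :=
  \col_i (i \in source G)%:R.

(* The (j, a) entry of the n x (n + m) matrix c(x) = [- c_0(x), c_1(x)]. *)
Definition coef (R : realType) n (G : network R n) (x : 'cV[R]_n)
    (j : 'I_n) (a : channel G) : R :=
  match a with
  | inl i => if i == j then - x j 0 else 0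
  | inr e => if (val e).2 == j then (1 - x j 0) * x (val e).1 0 else 0
  end.

Definition coef_mul (R : realType) n (G : network R n)
    (c : 'I_n -> channel G -> R) (v : channel G -> R) : 'cV[R]_n :=
  \col_j \sum_(a : channel G) c j a * v a.

Section independence.
Context (d : measure_display) (Omega : measurableType d) (R : realType).
Context (P : probability Omega R).

Definition mutually_independent (I : eqType) (F : I -> set (set Omega)) : Prop :=
  forall (s : seq I) (A : I -> set Omega), uniq s ->
    (forall i, i \in s -> F i (A i)) ->
    P (\bigcap_(i in [set` s]) A i) = (\prod_(i <- s) fine (P (A i)))%:E.

Definition sigma_rv (d' : measure_display) (S : measurableType d')
    (X : Omega -> S) : set (set Omega) :=
  preimage_set_system setT X measurable.

Definition sigma_process (N : R -> Omega -> nat) : set (set Omega) :=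
  <<s \bigcup_(t in [set t : R | 0 <= t]) sigma_rv (N t) >>.

(* The truncated subtractions on nat below are exact because the paths are
   nondecreasing.  The second argument of [poisson_prob] is a dummy. *)
Definition poisson_process (lambda : R) (N : R -> Omega -> nat) : Prop :=
  [/\ forall t, 0 <= t -> measurable_fun setT (N t),
      forall w, N 0 w = 0%N,
      forall w,
        (forall s t, 0 <= s -> s <= t -> (N s w <= N t w)%N) /\
        (forall t, 0 <= t -> \forall s \near t^'+, N s w = N t w),
      forall s t (A : set nat), 0 <= s -> s <= t ->
        P [set w | A (N t w - N s w)%N] = poisson_prob (lambda * (t - s)) 0 A
    & forall (p : nat) (t : nat -> R), 0 <= t 0%N ->
        (forall i, t i <= t i.+1) ->
        mutually_independent
          (fun i : 'I_p => sigma_rv (fun w => N (t i.+1) w - N (t i) w)%N)].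

End independence.

Definition independent_poisson_driver (R : realType) n (G : network R n)
    (d : measure_display) (Omega : measurableType d) (P : probability Omega R)
    (J : channel G -> R -> Omega -> nat) : Prop :=
  (forall a, poisson_process P (rate a) (J a)) /\
  mutually_independent P (fun a => sigma_process (J a)).

Definition cadlag (R : realType) (V : normedModType R) (x : R -> V) : Prop :=
  (forall t, 0 <= t -> x r @[r --> t^'+] --> x t) /\
  (forall t, 0 < t -> cvg (x r @[r --> t^'-])).

Definition left_limit (R : realType) (V : normedModType R) (x : R -> V) (t : R) : V :=
  lim (x r @[r --> t^'-]).

(* J has finitely many jumps in ]0, t], so that the pathwise Stieltjes integral
   of c(X(s-)) dJ(s) over ]0, t] is a finite sum over the jump times. *)
Definition jump_sde_solution (R : realType) n (G : network R n)
    (d : measure_display) (Omega : measurableType d) (P : probability Omega R)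
    (J : channel G -> R -> Omega -> nat) (X : R -> Omega -> 'cV[R]_n) : Prop :=
  (forall t i, 0 <= t -> measurable_fun setT (fun w => X t w i 0)) /\
  {ae P, forall w, cadlag (X ^~ w) /\
    forall t, 0 <= t ->
      X t w = x_init G + \sum_(s \in `]0, t]%classic)
        coef_mul (coef (left_limit (X ^~ w) s))
          (fun a : channel G => (J a s w)%:R
             - left_limit (fun r => (J a r w)%:R : R^o) s)}.

Inductive scheme := Euler | Taylor.

Definition scheme_step (R : realType) n (G : network R n) (sch : scheme)
    (x : 'cV[R]_n) (v : channel G -> R) : 'cV[R]_n :=
  let y := x + coef_mul (coef x) v in
  match sch with
  | Euler => y
  | Taylor => y + 2^-1 *: coef_mul (fun j a => coef y j a - coef x j a)
                            (fun a => v a * (v a - 1))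
  end.

(* X^h_k; [v k a] is the a-th coordinate of Delta J_k. *)
Fixpoint scheme_run (R : realType) n (G : network R n) (sch : scheme)
    (v : nat -> channel G -> R) (k : nat) : 'cV[R]_n :=
  match k with
  | 0 => x_init G
  | k'.+1 => scheme_step sch (scheme_run sch v k') (v k')
  end.

(* X^h(T), meaningful when T / h is a natural number. *)
Definition scheme_final (R : realType) n (G : network R n) (sch : scheme)
    (T h : R) (v : nat -> channel G -> R) : 'cV[R]_n :=
  scheme_run sch v (Num.truncn (T / h)).

Definition driver_increment (R : realType) n (G : network R n) (Omega : Type)
    (J : channel G -> R -> Omega -> nat) (h : R) (w : Omega)
    (k : nat) (a : channel G) : R :=
  (J a (k.+1%:R * h) w)%:R - (J a (k%:R * h) w)%:R.

Definition enorm (R : realType) n (x : 'cV[R]_n) : R :=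
  Num.sqrt (\sum_i x i 0 ^+ 2).

(* Iterated partial derivatives, one for each word of coordinate indices. *)
Fixpoint partials (R : realType) n (s : seq 'I_n) (g : 'cV[R]_n -> R) :
    'cV[R]_n -> R :=
  match s with
  | [::] => g
  | i :: s' => 'D_(delta_mx i 0) (partials s' g : 'cV[R]_n -> R^o)
  end.

Definition poly_growth (R : realType) n (f : 'cV[R]_n -> R) : Prop :=
  exists (C : R) (s : nat), forall x, `|f x| <= C * (1 + enorm x ^+ s).

(* The class C_P^r. *)
Definition smooth_poly (R : realType) n (r : nat) (g : 'cV[R]_n -> R) : Prop :=
  [/\ forall s : seq 'I_n, (size s < r)%N -> forall (i : 'I_n) x,
        derivable (partials s g : 'cV[R]_n -> R^o) x (delta_mx i 0),
      forall s : seq 'I_n, (size s <= r)%N -> continuous (partials s g)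
    & forall s : seq 'I_n, (0 < size s <= r)%N -> poly_growth (partials s g)].

Section weak_order.
Context (R : realType) (n : nat) (G : network R n).
Context (d : measure_display) (Omega : measurableType d) (P : probability Omega R).
Context (J : channel G -> R -> Omega -> nat) (X : R -> Omega -> 'cV[R]_n).

(* Stated in \bar R: it cannot hold unless both expectations are finite. *)
Definition weak_error_le (sch : scheme) (T : R) (g : 'cV[R]_n -> R)
    (beta C h : R) : Prop :=
  (`| 'E_P[fun w => g (scheme_final sch T h (driver_increment J h w))]
      - 'E_P[fun w => g (X T w)] | <= (C * h `^ beta)%:E)%E.

Definition weak_order_constant (sch : scheme) (T : R) (g : 'cV[R]_n -> R)
    (beta C : R) : Prop :=
  exists2 h0 : R, 0 < h0 & forall h, 0 < h < h0 -> T / h \is a Num.nat ->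
    weak_error_le sch T g beta C h.

(* C_P^{2 beta + 2} only makes sense when 2 beta + 2 is a natural number. *)
Definition has_weak_order (sch : scheme) (T beta : R) : Prop :=
  exists2 r : nat, r%:R = 2 * beta + 2 &
    forall g : 'cV[R]_n -> R, smooth_poly r g ->
      exists2 C : R, 0 < C & weak_order_constant sch T g beta C.

End weak_order.

Definition poisson_cdf (R : realType) (lambda x : R) : R :=
  fine (poisson_prob lambda 0 [set k : nat | k%:R <= x]).

Definition generalized_inverse (R : realType) (F : R -> R) (u : R) : R :=
  inf [set x | u <= F x].

Section antithetic.
Context (R : realType) (n : nat) (G : network R n).
Context (d : measure_display) (Omega : measurableType d) (P : probability Omega R).

(* The random inputs for M pairs of trajectories.  In a pair, [true] stands for
   the trajectory driven by Z^+ and [false] for the one driven by Z^-.  The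
   points come from i.i.d. sequences of which only the first Z^+ or Z^- terms
   are used.  Laws are compared on measurable sets only: on other sets
   [distribution] and [uniform_prob] carry no meaning. *)
Definition antithetic_input (T : R) (T_gt0 : 0 < T) (M : nat)
    (U : channel G -> 'I_M -> {RV P >-> R})
    (xi : channel G -> 'I_M -> bool -> nat -> {RV P >-> R}) : Prop :=
  [/\ forall a l (A : set R), measurable A ->
        distribution P (U a l) A = uniform_prob (@ltr01 R) A,
      forall a l b p (A : set R), measurable A ->
        distribution P (xi a l b p) A = uniform_prob T_gt0 A
    & mutually_independent P
        (fun i : (channel G * 'I_M) + (channel G * 'I_M * bool * nat) =>
          match i with
          | inl (a, l) => sigma_rv (U a l)
          | inr (a, l, b, p) => sigma_rv (xi a l b p)
          end)].

Context (T h : R) (M : nat).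
Context (U : channel G -> 'I_M -> {RV P >-> R}).
Context (xi : channel G -> 'I_M -> bool -> nat -> {RV P >-> R}).

(* The generalized inverse of a Poisson cdf on ]0, 1[ takes natural values, so
   that [truncn] is a mere cast. *)
Definition antithetic_count (a : channel G) (l : 'I_M) (b : bool) (w : Omega) : nat :=
  Num.truncn (generalized_inverse (poisson_cdf (rate a * T))
    (if b then 1 - U a l w else U a l w)).

Definition antithetic_increment (l : 'I_M) (b : bool) (w : Omega)
    (k : nat) (a : channel G) : R :=
  \sum_(p < antithetic_count a l b w | k%:R * h <= xi a l b p w < k.+1%:R * h) 1.

End antithetic.

(* u_T(h, L): trajectories l and L/2 + l are the two members of pair l. *)
Definition antithetic_estimator (R : realType) n (G : network R n)
    (d : measure_display) (Omega : measurableType d) (P : probability Omega R)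
    (sch : scheme) (g : 'cV[R]_n -> R) (T h : R) (L : nat)
    (U : channel G -> 'I_(L./2) -> {RV P >-> R})
    (xi : channel G -> 'I_(L./2) -> bool -> nat -> {RV P >-> R})
    (w : Omega) : R :=
  L%:R^-1 * \sum_(l < L./2)
    (g (scheme_final sch T h (antithetic_increment T h U xi l true w)) +
     g (scheme_final sch T h (antithetic_increment T h U xi l false w))).

Definition rmse (d : measure_display) (Omega : measurableType d) (R : realType)
    (P : probability Omega R) (u : Omega -> R) (mu : R) : \bar R :=
  ('E_P[fun w => (`|u w - mu| ^+ 2)%R] `^ 2^-1)%E.

(* Main.v *)
Require Import Defs.
From HB Require Import structures.
From mathcomp Require Import all_boot all_order all_algebra.
From mathcomp Require Import all_classical all_reals all_analysis.
From mathcomp Require Import measurable_realfun.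
From mathcomp Require Import ring lra zify.

Set Implicit Arguments.
Unset Strict Implicit.
Unset Printing Implicit Defensive.

Import Order.TTheory GRing.Theory Num.Theory.
Import numFieldNormedType.Exports.

Local Open Scope classical_set_scope.
Local Open Scope ring_scope.

(** Split the mean squared error into squared bias and variance.

    The increments produced by the algorithm have the law of the increments of
    the driving Poisson processes, so each summand of the estimator has the law
    of g(X^h(T)).  The bias is then exactly the weak error, at most C h^beta.
    Trajectories from different pairs are independent and therefore
    uncorrelated; inside a pair, 2ab <= a^2 + b^2 bounds the covariance by the
    variance, so antithetic coupling at worst doubles the variance of an average
    of L independent copies.  This gives the bound 2 E[g(X^h(T))^2] / L
    ([mean_square_error_le]), whatever the sign of the correlation.

    It remains to bound E[g(X^h(T))^2] uniformly in h
    ([second_moments_boundedP]).  Since the first derivatives of g have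
    polynomial growth, so has g, hence g^2 is again of class C_P and the weak
    order hypothesis applies to g^2: for h below some h1 the second moment is at
    most E[g(X(T))^2] + C'.  The other admissible h are of the form T / k
    with k bounded, thus finite in number, and for each of them the second
    moment is finite because X^h(T) is a polynomial in finitely many Poisson
    variables.  The resulting bound is a property of the scheme alone, so one
    constant serves every beta.

    Equality in law ([antithetic_increments_law]) is Poisson splitting.  Given
    Z points, the event that the intervals contain prescribed numbers of points
    is, up to a null set, the disjoint union over all ways of placing the points
    into the intervals of intersections of independent events; counting the
    placements yields the multinomial coefficient, and the Poisson weight of Z
    factors into a product of Poisson weights.  As increments are integers, a
    whole trajectory is a function of one natural number, and transfer of
    expectations and factorization over independent pairs take place on nat. *)

(** * Grouping independent events *)

Lemma measure_finType_bigcup d (Omega : measurableType d) (R : realType)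
    (P : {measure set Omega -> \bar R}) (I : finType) (D : I -> set Omega) :
  trivIset setT D -> (forall t, measurable (D t)) ->
  P (\bigcup_t D t) = (\sum_t P (D t))%E.
Proof.
move=> tD mD; rewrite measure_fin_bigcup//= fsbig_finite//=.
apply: perm_big; rewrite uniq_perm ?index_enum_uniq ?finmap.fset_uniq//.
move=> t; rewrite mem_index_enum in_fset_set ?in_setT//.
exact: finite_finset.
Qed.

Section grouping.
Context d (Omega : measurableType d) (R : realType) (P : probability Omega R).

Definition blocks (J I : eqType) (F : J -> set (set Omega)) (blk : J -> I)
    (i : I) : set (set Omega) :=
  [set B | exists (s : seq J) (A : J -> set Omega),
    [/\ uniq s, forall j, j \in s -> blk j = i,
        forall j, j \in s -> F j (A j) & B = \bigcap_(j in [set` s]) A j]].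

Lemma uniq_flatten_blocks (J I : eqType) (blk : J -> I) (ss : I -> seq J)
    (s : seq I) :
  uniq s -> (forall i, i \in s -> uniq (ss i)) ->
  (forall i, i \in s -> forall j, j \in ss i -> blk j = i) ->
  uniq (flatten [seq ss i | i <- s]).
Proof.
elim: s => [//|i s IH] /= /andP[iNs us] uss bss.
rewrite cat_uniq uss ?mem_head//=; apply/andP; split; last first.
  apply: IH => // i' i's; first by apply: uss; rewrite inE i's orbT.
  by apply: bss; rewrite inE i's orbT.
apply/hasPn => j /flatten_mapP[i' i's ji'].
apply/negP => ji; move: iNs; rewrite -(bss i _ j ji) ?mem_head//.
by rewrite (bss i' _ j ji') ?i's// inE i's orbT.
Qed.

(** Independence survives grouping the families by labels: an intersection of
    blocks with distinct labels is one long intersection over distinct indices,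
    because blocks with distinct labels share no index. *)
Lemma mutually_independent_blocks (J I : eqType) (F : J -> set (set Omega))
    (blk : J -> I) :
  mutually_independent P F -> mutually_independent P (blocks F blk).
Proof.
move=> indF s A us FA.
have /choice[p pP] : forall i, exists p : seq J * (J -> set Omega), i \in s ->
    [/\ uniq p.1, forall j, j \in p.1 -> blk j = i,
        forall j, j \in p.1 -> F j (p.2 j)
      & A i = \bigcap_(j in [set` p.1]) p.2 j].
  move=> i; have [is_|iNs] := boolP (i \in s); last by exists ([::], fun=> set0).
  by have [t [B H]] := FA i is_; exists (t, B).
pose B j := (p (blk j)).2 j.
have AE i : i \in s -> A i = \bigcap_(j in [set` (p i).1]) B j.
  move=> is_; have [_ bi _ ->] := pP i is_.
  by apply: eq_bigcapr => j /= /bi bj; rewrite /B bj.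
have FB i : i \in s -> forall j, j \in (p i).1 -> F j (B j).
  by move=> is_ j jp; have [_ bi Fi _] := pP i is_; rewrite /B (bi j jp); exact: Fi.
have -> : \bigcap_(i in [set` s]) A i =
    \bigcap_(j in [set` flatten [seq (p i).1 | i <- s]]) B j.
  apply/seteqP; split => w /= H.
    by move=> j /= /flatten_mapP[i is_ ji]; have := H i is_; rewrite AE//; exact.
  by move=> i /= is_; rewrite AE// => j /= ji; apply: H; apply/flatten_mapP; exists i.
rewrite indF; first last.
- by move=> j /flatten_mapP[i is_ ji]; exact: FB ji.
- by apply: (uniq_flatten_blocks (blk := blk)) => // i /pP[].
congr (_%:E); rewrite big_flatten big_map; apply: eq_big_seq => i is_.
have [ui _ _ _] := pP i is_.
by rewrite AE// indF//; exact: FB.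
Qed.

Definition disjoint_unions (I : Type) (F : I -> set (set Omega)) (i : I) :
    set (set Omega) :=
  [set B | exists (C : finType) (D : C -> set Omega),
    [/\ trivIset setT D, forall t, F i (D t) & B = \bigcup_t D t]].

(** Both sides of the product rule are additive in each event separately, so
    the events can be replaced by disjoint unions one label at a time; [s1]
    below holds the labels already replaced. *)
Lemma mutually_independent_disjoint_unions (I : eqType)
    (F : I -> set (set Omega)) :
  (forall i A, F i A -> measurable A) ->
  mutually_independent P F -> mutually_independent P (disjoint_unions F).
Proof.
move=> mF indF s A us FA.
suff: forall s1 s2 A, uniq (s1 ++ s2) ->
    (forall i, i \in s1 -> disjoint_unions F i (A i)) ->
    (forall i, i \in s2 -> F i (A i)) ->
    P (\bigcap_(i in [set` s1 ++ s2]) A i) =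
    (\prod_(i <- s1 ++ s2) fine (P (A i)))%:E.
  by move=> /(_ s [::] A); rewrite cats0; exact.
elim=> [|i s1 IH] s2 B u12 F1 F2; first exact: indF.
have [m [D [tD FD BE]]] := F1 i (mem_head _ _).
have mD t : measurable (D t) by exact: mF (FD t).
pose C t j := if j == i then D t else B j.
have u12' : uniq (s1 ++ i :: s2) by rewrite -cat1s uniq_catCA.
have iN : i \notin s1 ++ s2 by case/andP: u12.
have CE t j : j \in s1 ++ s2 -> C t j = B j.
  by move=> js; rewrite /C; case: eqP => // ji; rewrite -ji js in iN.
have F1C t j : j \in s1 -> disjoint_unions F j (C t j).
  by move=> js; rewrite CE ?mem_cat ?js//; apply: F1; rewrite inE js orbT.
have F2C t j : j \in i :: s2 -> F j (C t j).
  rewrite inE => /orP[/eqP->|js]; first by rewrite /C eqxx.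
  by rewrite CE ?mem_cat ?js ?orbT//; exact: F2.
have PC t : P (\bigcap_(j in [set` s1 ++ i :: s2]) C t j) =
    (fine (P (D t)) * \prod_(j <- s1 ++ s2) fine (P (B j)))%:E.
  rewrite IH//; last 2 first. exact: F1C. exact: F2C.
  rewrite (perm_big (i :: s1 ++ s2)) /=; last by rewrite -cat1s perm_catCA.
  rewrite big_cons {1}/C eqxx; congr (_ * _)%:E.
  by apply: eq_big_seq => j js; rewrite CE.
have mB j : j \in s1 ++ s2 -> measurable (B j).
  rewrite mem_cat => /orP[js|js]; last exact: mF (F2 _ js).
  have [|k [E [_ FE ->]]] := F1 j; first by rewrite inE js orbT.
  by apply: fin_bigcup_measurable => // t _; exact: mF (FE t).
have mC t : measurable (\bigcap_(j in [set` s1 ++ i :: s2]) C t j).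
  apply: fin_bigcap_measurable; first exact: finite_seq.
  move=> j /=; rewrite mem_cat inE orbCA => /orP[/eqP->|]; first by rewrite /C eqxx.
  by rewrite -mem_cat => js; rewrite CE//; exact: mB.
have -> : \bigcap_(j in [set` (i :: s1) ++ s2]) B j =
    \bigcup_t (\bigcap_(j in [set` s1 ++ i :: s2]) C t j).
  apply/seteqP; split => w /=.
    move=> H; have := H i (mem_head _ _); rewrite BE => -[t _ Dt].
    exists t => // j /=; rewrite mem_cat inE orbCA => /orP[/eqP->|].
      by rewrite /C eqxx.
    by rewrite -mem_cat => js; rewrite CE//; apply: H; rewrite /= inE js orbT.
  move=> [t _ H] j /=; rewrite inE => /orP[/eqP->|js].
    rewrite BE; exists t => //; have := H i; rewrite /C eqxx; apply.
    by rewrite /= mem_cat mem_head orbT.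
  have := H j; rewrite CE//; apply => /=.
  by move: js; rewrite !mem_cat inE => /orP[->//|->]; rewrite !orbT.
rewrite measure_finType_bigcup//; last first.
  move=> t t' _ _ [w [Ht Ht']]; apply: tD => //.
  have := Ht i; have := Ht' i; rewrite /C /= mem_cat mem_head orbT eqxx => H1 H2.
  by exists w; split; [exact: H2|exact: H1].
rewrite (eq_bigr _ (fun t _ => PC t)) sumEFin -mulr_suml big_cons; congr (_ * _)%:E.
rewrite BE measure_finType_bigcup//.
by rewrite -sum_fine// => t _; exact: fin_num_measure.
Qed.

End grouping.

(** * Poisson law and its quantile function *)

Section poisson_law.
Context (R : realType).
Implicit Types (r : R) (k z : nat).

(** The mass function [poisson_pmf] equals 1 everywhere at rate 0; this
    one is the Dirac mass at 0 there, which the model without recovery needs. *)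
Definition pois r k : R := r ^+ k / k`!%:R * expR (- r).

Lemma pois_ge0 r k : 0 <= r -> 0 <= pois r k.
Proof. by move=> r0; rewrite /pois mulr_ge0 ?expR_ge0// divr_ge0// exprn_ge0. Qed.

Lemma poisson_prob_set1 r k : 0 <= r -> poisson_prob r 0 [set k] = (pois r k)%:E.
Proof.
rewrite le_eqVlt => /orP[/eqP<-|r0]; rewrite /poisson_prob.
  rewrite ltxx diracE /pois oppr0 expR0 mulr1; case: k => [|k].
    by rewrite mem_set//= expr0 fact0 divr1.
  by rewrite memNset//= exprS !mul0r.
by rewrite r0 esum_set1 /poisson_pmf r0// lee_fin -/(pois r k) pois_ge0// ltW.
Qed.

Definition cumul r z : R := \sum_(k < z) pois r k.

Lemma poisson_prob_II r z : 0 <= r -> poisson_prob r 0 `I_z = (cumul r z)%:E.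
Proof.
move=> r0; elim: z => [|z IH]; first by rewrite II0 measure0 /cumul big_ord0.
rewrite IIS measureU//; last first.
  by apply/seteqP; split => // k /= [+ kz]; rewrite kz ltnn.
transitivity ((cumul r z)%:E + (pois r z)%:E)%E; last by rewrite /cumul big_ord_recr.
by congr (_ + _)%E; [exact: IH|exact: poisson_prob_set1].
Qed.

Lemma cumul_ge0 r z : 0 <= r -> 0 <= cumul r z.
Proof. by move=> r0; rewrite sumr_ge0// => k _; exact: pois_ge0. Qed.

Lemma cumul_le1 r z : 0 <= r -> cumul r z <= 1.
Proof. by move=> r0; rewrite -lee_fin -poisson_prob_II// probability_le1. Qed.

Lemma cumul_nondecreasing r z z' : 0 <= r -> (z <= z')%N -> cumul r z <= cumul r z'.
Proof.
move=> r0 zz'; rewrite -lee_fin -!poisson_prob_II// le_measure ?inE//.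
by move=> k /= /leq_trans; exact.
Qed.

Lemma poisson_cdfE r x : 0 <= r -> 0 <= x ->
  poisson_cdf r x = cumul r (Num.truncn x).+1.
Proof.
move=> r0 x0; rewrite /poisson_cdf.
have -> : [set k : nat | k%:R <= x] = `I_(Num.truncn x).+1.
  by apply/seteqP; split => k /=; rewrite ltnS truncn_ge_nat.
by rewrite poisson_prob_II.
Qed.

Lemma poisson_cdf_lt0 r x : x < 0 -> poisson_cdf r x = 0.
Proof.
move=> x0; rewrite /poisson_cdf.
have -> : [set k : nat | k%:R <= x] = set0.
  by apply/seteqP; split => k //= /le_lt_trans/(_ x0); rewrite ltrn0.
by rewrite measure0.
Qed.

Definition quantile r (u : R) : nat :=
  Num.truncn (generalized_inverse (poisson_cdf r) u).

(** The uniform variates that the inverse transform sends to [z]. *)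
Definition quantile_itv r z : set R := `]cumul r z, cumul r z.+1].

Lemma quantileE r z u : 0 <= r -> quantile_itv r z u -> quantile r u = z.
Proof.
move=> r0; rewrite /quantile_itv /= in_itv /= => /andP[zu uz].
have u0 : 0 < u by rewrite (le_lt_trans _ zu)// cumul_ge0.
rewrite /quantile /generalized_inverse.
suff -> : [set x | u <= poisson_cdf r x] = `[z%:R, +oo[%classic.
  by rewrite inf_itv// natrK.
apply/seteqP; split => x /=; rewrite in_itv /= andbT.
  move=> ux; have [x0|x0] := ltP x 0.
    by move: ux; rewrite poisson_cdf_lt0// leNgt u0.
  move: ux; rewrite poisson_cdfE//; rewrite -truncn_ge_nat//.
  move=> ux; rewrite leqNgt; apply/negP => xz.
  by have := cumul_nondecreasing r0 xz; rewrite leNgt (lt_le_trans zu).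
move=> zx; have x0 : 0 <= x by rewrite (le_trans _ zx).
rewrite poisson_cdfE// (le_trans uz)// cumul_nondecreasing// ltnS.
by rewrite truncn_ge_nat.
Qed.

(** Outside these intervals the set whose infimum is taken is either the whole
    line or empty, and both have infimum 0 by convention.  This pins the
    quantile down on a null set, which makes it measurable. *)
Lemma quantile_out r u : 0 <= r -> ~ (\bigcup_z quantile_itv r z) u -> quantile r u = 0%N.
Proof.
move=> r0 uN; rewrite /quantile /generalized_inverse.
have [u0|u0] := leP u 0.
  have -> : [set x | u <= poisson_cdf r x] = setT.
    apply/seteqP; split => // x _ /=; have [x0|x0] := ltP x 0.
      by rewrite poisson_cdf_lt0.
    by rewrite poisson_cdfE// (le_trans u0)// cumul_ge0.
  rewrite inf_out ?truncn0// => -[_ [m mP]].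
  by have := mP (m - 1) I; rewrite leNgt ltrBlDr ltrDl ltr01.
have -> : [set x | u <= poisson_cdf r x] = set0.
  apply/seteqP; split => // x /=; have [x0|x0] := ltP x 0.
    by rewrite poisson_cdf_lt0// leNgt u0.
  rewrite poisson_cdfE// => ux; apply: uN.
  have exz : exists z, u <= cumul r z.+1 by exists (Num.truncn x).
  case: (ex_minnP exz) => z uz zmin; exists z => //=.
  rewrite /quantile_itv /= in_itv /= uz andbT ltNge; apply/negP => uz'.
  case: z uz zmin uz' => [|z] uz zmin uz'.
    by move: uz'; rewrite /cumul big_ord0 leNgt u0.
  by have := zmin z uz'; rewrite ltnn.
by rewrite inf0 truncn0.
Qed.

Lemma measurable_quantile r z : 0 <= r -> measurable (quantile r @^-1` [set z]).
Proof.
move=> r0; have mI k : measurable (quantile_itv r k) by exact: measurable_itv.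
have mU : measurable (\bigcup_k quantile_itv r k) by exact: bigcupT_measurable.
suff -> : quantile r @^-1` [set z] = quantile_itv r z `|`
    (if z == 0%N then ~` \bigcup_k quantile_itv r k else set0).
  by apply: measurableU => //; case: ifP => // _; exact: measurableC.
apply/seteqP; split => u /=.
  move=> qz; have [[k _ uk]|uN] := pselect ((\bigcup_k quantile_itv r k) u).
    by left; rewrite -qz (quantileE r0 uk).
  by right; rewrite -qz quantile_out// eqxx.
move=> [|]; first exact: quantileE.
by case: ifPn => // /eqP-> uN; rewrite quantile_out.
Qed.

Lemma trivIset_quantile_itv r : 0 <= r -> trivIset setT (quantile_itv r).
Proof. by move=> r0 z z' _ _ [u [/(quantileE r0) <- /(quantileE r0) <-]]. Qed.

End poisson_law.

Section uniform_law.
Context (R : realType).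

Lemma uniform_prob_sub (a b : R) (ab : a < b) (A : set R) : measurable A ->
  A `<=` `[a, b] -> uniform_prob ab A = ((b - a)^-1%:E * lebesgue_measure A)%E.
Proof.
move=> mA Aab; rewrite /uniform_prob (eq_integral (fun=> (b - a)^-1%:E)).
  by rewrite integral_cst.
by move=> x /[!inE] /Aab /=; rewrite in_itv /= /uniform_pdf => ->.
Qed.

Lemma uniform_quantile_itv (r : R) z : 0 <= r ->
  uniform_prob (@ltr01 R) (quantile_itv r z) = (pois r z)%:E.
Proof.
move=> r0; rewrite uniform_prob_sub; first last.
- move=> x; rewrite /quantile_itv /= !in_itv /= => /andP[zx xz].
  by rewrite (le_trans _ (ltW zx)) ?cumul_ge0// (le_trans xz)// cumul_le1.
- exact: measurable_itv.
rewrite subr0 invr1 mul1e lebesgue_measure_itv /= lte_fin.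
rewrite /cumul big_ord_recr/= ltrDl; case: ifPn => [_|].
  by rewrite -EFinB; congr EFin; ring.
by rewrite -leNgt => p0; congr EFin; apply/eqP; rewrite eq_le p0 pois_ge0.
Qed.

(** Reflection preserves the uniform law: this is why the two members of an
    antithetic pair have the same law. *)
Lemma uniform_rev_quantile_itv (r : R) z : 0 <= r ->
  uniform_prob (@ltr01 R) ((fun u => 1 - u) @^-1` quantile_itv r z) = (pois r z)%:E.
Proof.
move=> r0.
have -> : (fun u => 1 - u) @^-1` quantile_itv r z =
    `[1 - cumul r z.+1, 1 - cumul r z[%classic.
  by apply/seteqP; split => x /=; rewrite /quantile_itv /= !in_itv /= => /andP[? ?];
     apply/andP; split; lra.
rewrite uniform_prob_sub; first last.
- move=> x; rewrite /= !in_itv /= => /andP[zx xz].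
  have := cumul_ge0 z r0; have := cumul_le1 z.+1 r0; lra.
- exact: measurable_itv.
rewrite subr0 invr1 mul1e lebesgue_measure_itv /= lte_fin ltrD2l ltrN2.
rewrite /cumul big_ord_recr/= ltrDl; case: ifPn => [_|].
  by rewrite -EFinB; congr EFin; ring.
by rewrite -leNgt => p0; congr EFin; apply/eqP; rewrite eq_le p0 pois_ge0.
Qed.

Lemma uniform_bin (T h : R) (T0 : 0 < T) (K k : nat) : T = K%:R * h -> 0 < h ->
  (k < K)%N -> uniform_prob T0 `[k%:R * h, k.+1%:R * h[%classic = (K%:R^-1)%:E.
Proof.
move=> TE h0 kK; rewrite uniform_prob_sub; first last.
- move=> x; rewrite /= !in_itv /= => /andP[kx xk].
  rewrite (le_trans _ kx) ?mulr_ge0 ?(ltW h0)//=.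
  by rewrite (le_trans (ltW xk))// TE ler_pM2r// ler_nat.
- exact: measurable_itv.
rewrite subr0 lebesgue_measure_itv /= lte_fin ltr_pM2r// ltr_nat ltnSn.
rewrite -EFinB -EFinM; congr EFin; rewrite TE -natr1; field.
have K0 : K%:R != 0 :> R by rewrite pnatr_eq0 -lt0n (leq_ltn_trans _ kK).
by rewrite K0 gt_eqF.
Qed.

End uniform_law.

(** * Multinomial coefficients *)

Section multinomial.
Context (K : nat).
Implicit Types (c : 'I_K -> nat).
Local Open Scope nat_scope.

Definition has_counts (z : nat) c : pred (z.-tuple 'I_K) :=
  [pred t : z.-tuple 'I_K | [forall k, count_mem k t == c k]].
Arguments has_counts : clear implicits.

(** Classify the words by their first letter. *)
Lemma card_has_counts_rec z c :
  #|has_counts z.+1 c| =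
  \sum_(k | 0 < c k) #|has_counts z (fun j => c j - (j == k))|.
Proof.
rewrite -sum1_card big_mkcond.
rewrite (reindex (fun p : 'I_K * z.-tuple 'I_K => cons_tuple p.1 p.2)) /=; last first.
  exists (fun t => (thead t, behead_tuple t)) => [[k t]|t] _ /=.
    by rewrite theadE; congr pair; exact/val_inj.
  by rewrite [RHS]tuple_eta; exact/val_inj.
rewrite -(pair_bigA _ (fun k t =>
  if cons_tuple k t \in has_counts z.+1 c then 1 else 0)) /=.
rewrite [RHS]big_mkcond; apply: eq_bigr => k _.
case: ifPn => [ck|]; last first.
  rewrite -eqn0Ngt => /eqP ck; rewrite big1// => t _; rewrite inE.
  case: forallP => // /(_ k) /=; rewrite eqxx ck addSn.
  by [].
rewrite -sum1_card [RHS]big_mkcond; apply: eq_bigr => t _; congr (if _ then _ else _).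
rewrite !inE; apply: eq_forallb => j /=; rewrite (eq_sym k j).
by case: (j =P k) => [->|_] /=; rewrite ?add0n ?subn0//; lia.
Qed.

(** The number of words with prescribed letter counts is a multinomial
    coefficient, stated without division to permit induction on the length. *)
Lemma card_has_counts z c : \sum_k c k = z ->
  #|has_counts z c| * \prod_k (c k)`! = z`!.
Proof.
elim: z c => [|z IH] c cz.
  have c0 k : c k = 0.
    by apply/eqP; rewrite -leqn0 -cz (bigD1 k)//= leq_addr.
  rewrite big1 ?muln1; last by move=> k _; rewrite c0.
  rewrite -sum1_card (eq_bigl predT) ?sum1_card ?card_tuple ?expn0// => t.
  by rewrite inE; apply/forallP => k; rewrite c0 tuple0.
rewrite card_has_counts_rec big_distrl /= factS -cz big_distrl /=.
rewrite [RHS](bigID (fun k => 0 < c k)) /= [X in _ = _ + X]big1 ?addn0; last first.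
  by move=> k; rewrite -eqn0Ngt => /eqP->.
apply: eq_bigr => k ck.
have cE : \sum_j (c j - (j == k)) = z.
  move: cz; rewrite (bigD1 k)//= [in X in _ -> X](bigD1 k)//= eqxx.
  by rewrite [in X in _ -> X](eq_bigr c) => [|j /negbTE->]; lia.
rewrite -(IH _ cE) mulnCA; congr (_ * _).
rewrite (bigD1 k)//= [in RHS](bigD1 k)//= eqxx subn1 -{1}(prednK ck) factS.
rewrite prednK// mulnA; congr (_ * _).
by apply: eq_bigr => j /negbTE->; rewrite subn0.
Qed.

End multinomial.
Arguments has_counts {K} z c.

(** * Law of the antithetic increments *)

Lemma eq_ae_measure d (Omega : measurableType d) (R : realType)
    (P : {measure set Omega -> \bar R}) (A B : set Omega) :
  measurable A -> measurable B -> {ae P, forall w, A w <-> B w} -> P A = P B.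
Proof.
move=> mA mB AB; rewrite -[A]setIT -[B]setIT -!integral_indic//.
apply: ae_eq_integral => //.
- exact/measurable_EFinP/measurable_indic.
- exact/measurable_EFinP/measurable_indic.
- apply: filterS AB => w AB _; rewrite !indicE.
  by congr (_%:R%:E); congr nat_of_bool; apply/idP/idP; rewrite !inE => /AB.
Qed.

Lemma prob1_ae d (Omega : measurableType d) (R : realType)
    (P : probability Omega R) (A : set Omega) :
  measurable A -> P A = 1%E -> {ae P, forall w, A w}.
Proof.
move=> mA PA; exists (~` A); split => //; first exact: measurableC.
by rewrite probability_setC// PA subee.
Qed.

Lemma rate_ge0 (R : realType) n (G : network R n) (a : channel G) : 0 <= rate a.
Proof.
case: a => [i|[[i j] e]] /=; last by rewrite ltW// activation_gt0.
by case: (recovery_sign G) => [/(_ i)/ltW|->].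
Qed.

(** The sign [b] chooses one trajectory from each pair: a choice of one sign per
    pair is what makes the selected trajectories independent. *)
Definition increments_event (R : realType) n (G : network R n)
    d (Omega : measurableType d) (P : probability Omega R) (T h : R) (M K : nat)
    (U : channel G -> 'I_M -> {RV P >-> R})
    (xi : channel G -> 'I_M -> bool -> nat -> {RV P >-> R})
    (b : 'I_M -> bool) (i : channel G * 'I_M) (c : 'I_K -> nat) : set Omega :=
  [set w | forall k : 'I_K,
     antithetic_increment T h U xi i.2 (b i.2) w k i.1 = (c k)%:R].

Section antithetic_law.
Context (R : realType) (n : nat) (G : network R n).
Context d (Omega : measurableType d) (P : probability Omega R).
Context (T h : R) (T0 : 0 < T) (M K : nat) (b : 'I_M -> bool).
Context (U : channel G -> 'I_M -> {RV P >-> R}).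
Context (xi : channel G -> 'I_M -> bool -> nat -> {RV P >-> R}).
Hypotheses (TE : T = K%:R * h) (h0 : 0 < h).
Hypothesis (inp : antithetic_input T0 U xi).

Local Notation I := (channel G * 'I_M)%type.
Local Notation J := ((channel G * 'I_M) + (channel G * 'I_M * bool * nat))%type.
Let F (i : J) := match i with
          | inl (a, l) => sigma_rv (U a l)
          | inr (a, l, b, p) => sigma_rv (xi a l b p)
          end.
Let blk (i : J) : I := match i with
          | inl (a, l) => (a, l)
          | inr (a, l, b, p) => (a, l)
          end.
Implicit Types (i : I).

Let lam i : R := rate i.1 * T.
Let lam_ge0 i : 0 <= lam i.
Proof. by rewrite mulr_ge0 ?rate_ge0// ltW. Qed.

Let V i (u : R) : R := if b i.2 then 1 - u else u.
Let bin (k : nat) : set R := `[k%:R * h, k.+1%:R * h[.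
Let xi' i p := xi i.1 i.2 (b i.2) p.

(** The list [s] encodes an assignment of points to time intervals: its size is
    the number of points and its p-th entry the interval of point p. *)
Let block_event i (s : seq nat) : set Omega :=
  [set w | quantile_itv (lam i) (size s) (V i (U i.1 i.2 w)) /\
           forall p, (p < size s)%N -> bin (nth 0%N s p) (xi' i p w)].

(** The almost sure event on which the counts determine an assignment of points. *)
Let good i (w : Omega) : Prop :=
  (\bigcup_z quantile_itv (lam i) z) (V i (U i.1 i.2 w)) /\
  forall p, 0 <= xi' i p w < T.

Let mQ i z : measurable (V i @^-1` quantile_itv (lam i) z).
Proof.
rewrite -[X in measurable X]setTI.
have mV : measurable_fun setT (V i).
  by rewrite /V; case: (b i.2) => //; exact: measurable_funB.
by apply: mV => //; exact: measurable_itv.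
Qed.

Let mVU i z : measurable ((V i \o U i.1 i.2) @^-1` quantile_itv (lam i) z).
Proof.
rewrite comp_preimage -[X in measurable X]setTI.
by apply: (measurable_funPT (U i.1 i.2)) => //; exact: mQ.
Qed.

Let mxi i p (A : set R) : measurable A -> measurable (xi' i p @^-1` A).
Proof.
move=> mA; rewrite -[X in measurable X]setTI.
by apply: (measurable_funPT (xi' i p)) => //; exact: mQ.
Qed.

Let PQ i z : P ((V i \o U i.1 i.2) @^-1` quantile_itv (lam i) z) =
  (pois (lam i) z)%:E.
Proof.
case: inp => HU _ _; rewrite comp_preimage.
have := HU i.1 i.2 _ (mQ i z); rewrite /distribution /pushforward => ->.
rewrite /V; case: (b i.2); first exact: uniform_rev_quantile_itv.
exact: uniform_quantile_itv.
Qed.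

Let mbin k : measurable (bin k). Proof. exact: measurable_itv. Qed.

Let Pbin i p k : (k < K)%N -> P (xi' i p @^-1` bin k) = (K%:R^-1)%:E.
Proof.
case: inp => _ Hxi _ kK.
have := Hxi i.1 i.2 (b i.2) p _ (mbin k); rewrite /distribution /pushforward => ->.
exact: uniform_bin.
Qed.

(** The quantile intervals carry total mass 1 because the Poisson masses sum
    to 1; a uniform point of [0, T] misses the endpoint T almost surely. *)
Let good_ae : {ae P, forall w, forall i, good i w}.
Proof.
apply: filter_forall => i; apply: filterI.
  apply: (@prob1_ae _ _ _ _ ((V i \o U i.1 i.2) @^-1` \bigcup_z quantile_itv (lam i) z)).
    rewrite preimage_bigcup; apply: bigcupT_measurable => z; exact: mVU.
  rewrite preimage_bigcup measure_semi_bigcup; first last.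
  - by apply: bigcupT_measurable => z; exact: mVU.
  - move=> z z' _ _ [w [/= wz wz']]; apply: (trivIset_quantile_itv (lam_ge0 i)) => //.
    by exists (V i (U i.1 i.2 w)).
  - by move=> z; exact: mVU.
  rewrite -(probability_setT (poisson_prob (lam i) 0)).
  have -> : [set: nat] = \bigcup_z [set z] by apply/seteqP; split => // z _; exists z.
  rewrite measure_semi_bigcup//; last by move=> z z' _ _ [k [-> ->]].
  by apply: eq_eseriesr => z _; rewrite [LHS]PQ [RHS]poisson_prob_set1.
apply/ae_foralln => p.
apply: (@prob1_ae _ _ _ _ (xi' i p @^-1` `[0, T[)).
  by apply: mxi; exact: measurable_itv.
case: inp => _ Hxi _.
have := Hxi i.1 i.2 (b i.2) p `[0, T[%classic (measurable_itv _).
rewrite /distribution /pushforward => ->.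
rewrite uniform_prob_sub//; last by move=> x; rewrite /= !in_itv /= => /andP[-> /ltW].
by rewrite subr0 lebesgue_measure_itv /= lte_fin T0 sube0 -EFinM mulVf// gt_eqF.
Qed.

Let block_index i (s : seq nat) : seq J :=
  inl i :: [seq inr (i.1, i.2, b i.2, p) | p <- iota 0 (size s)].

Let block_factor i (s : seq nat) (j : J) : set Omega :=
  match j with
  | inl _ => (V i \o U i.1 i.2) @^-1` quantile_itv (lam i) (size s)
  | inr (_, p) => xi' i p @^-1` bin (nth 0%N s p)
  end.

Let block_indexP i s (Q : J -> Prop) :
  (forall j, j \in block_index i s -> Q j) <->
  Q (inl i) /\ forall p, (p < size s)%N -> Q (inr (i.1, i.2, b i.2, p)).
Proof.
split=> [H|[Qi Qp] j /predU1P[->//|/mapP[p ps ->]]]; last first.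
  by apply: Qp; rewrite mem_iota in ps.
split; first by apply: H; exact: mem_head.
by move=> p ps; apply/H/predU1P; right; apply/mapP; exists p; rewrite ?mem_iota.
Qed.

Let block_factorP i s : forall j, j \in block_index i s ->
  blk j = i /\ F j (block_factor i s j).
Proof.
apply/block_indexP; case: i => a l; split=> [|p ps]; split => //.
  by exists (V (a, l) @^-1` quantile_itv (lam (a, l)) (size s));
    [exact: mQ|rewrite setTI].
by exists (bin (nth 0%N s p)); [exact: mbin|rewrite setTI].
Qed.

Let uniq_block_index i s : uniq (block_index i s).
Proof.
rewrite /= map_inj_uniq ?iota_uniq ?andbT; last by move=> p p' [].
by apply/negP => /mapP[].
Qed.

Let block_eventE i s :
  block_event i s = \bigcap_(j in [set` block_index i s]) block_factor i s j.
Proof.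
by apply/seteqP; split => w; rewrite /bigcap /=;
  [move=> H; apply/block_indexP|move/block_indexP].
Qed.

Let blocks_block_event i s : blocks F blk i (block_event i s).
Proof.
exists (block_index i s), (block_factor i s); split => //.
- by move=> j /block_factorP[].
- by move=> j /block_factorP[].
Qed.

Let P_block_event i s : all (fun k => (k < K)%N) s ->
  P (block_event i s) = (pois (lam i) (size s) * K%:R^-1 ^+ size s)%:E.
Proof.
move=> sK; case: inp => _ _ indF.
rewrite block_eventE indF; [|exact: uniq_block_index|by move=> j /block_factorP[]].
rewrite big_cons big_map /= PQ/=; congr (_ * _)%:E.
rewrite (eq_big_seq (fun=> K%:R^-1)).
  by rewrite big_const_seq count_predT size_iota -Monoid.iteropE.
move=> p; rewrite mem_iota /= => ps; rewrite Pbin//.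
by apply: (allP sK); rewrite mem_nth.
Qed.

Let Fmeas j A : F j A -> measurable A.
Proof.
by case: j => [[a l]|[[[a l] b'] p]] [B mB <-]; apply: measurable_funPT.
Qed.

Let blocks_meas i A : blocks F blk i A -> measurable A.
Proof.
move=> [s [B [_ _ FB ->]]]; apply: fin_bigcap_measurable; first exact: finite_seq.
by move=> j /= js; apply: Fmeas; exact: FB js.
Qed.

Let antithetic_countE i w z : quantile_itv (lam i) z (V i (U i.1 i.2 w)) ->
  antithetic_count T U i.1 i.2 (b i.2) w = z.
Proof. by move=> H; apply: (quantileE (lam_ge0 i)). Qed.

Let antithetic_incrementE i w k :
  antithetic_increment T h U xi i.2 (b i.2) w k i.1 =
  \sum_(p < antithetic_count T U i.1 i.2 (b i.2) w) \1_(bin k) (xi' i p w).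
Proof.
rewrite /antithetic_increment big_mkcond; apply: eq_bigr => p _.
by rewrite indicE /bin; case: ifPn => H;
  [rewrite mem_set//=|rewrite memNset//= in_itv/=; apply/negP].
Qed.

Let measurable_count i z :
  measurable (antithetic_count T U i.1 i.2 (b i.2) @^-1` [set z]).
Proof.
have -> : antithetic_count T U i.1 i.2 (b i.2) = quantile (lam i) \o (V i \o U i.1 i.2).
  by [].
rewrite comp_preimage -[X in measurable X]setTI.
have mV : measurable_fun setT (V i \o U i.1 i.2).
  apply: measurableT_comp => //; rewrite /V; case: (b i.2) => //.
  exact: measurable_funB.
by apply: mV => //; exact: measurable_quantile.
Qed.

Lemma measurable_increments_event i (c : 'I_K -> nat) :
  measurable (increments_event T h U xi b i c).
Proof.
have -> : increments_event T h U xi b i c = \bigcup_z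
   (antithetic_count T U i.1 i.2 (b i.2) @^-1` [set z] `&`
    \bigcap_(k in [set: 'I_K])
      [set w | \sum_(p < z) \1_(bin k) (xi' i p w) = (c k)%:R :> R]).
  apply/seteqP; split => w /=.
    move=> H; exists (antithetic_count T U i.1 i.2 (b i.2) w) => //; split => // k _ /=.
    by rewrite -antithetic_incrementE.
  by move=> [z _ [/= <- H]] k; rewrite antithetic_incrementE; exact: (H k).
apply: bigcupT_measurable => z; apply: measurableI; first exact: measurable_count.
apply: fin_bigcap_measurable => // k _.
have mf : measurable_fun setT (fun w => \sum_(p < z) \1_(bin k) (xi' i p w) : R).
  apply: measurable_sum => p.
  apply: measurableT_comp; [ | exact: (measurable_funPT (xi' i p))].
  by apply measurable_indic; exact: mbin.
rewrite -[X in measurable X]setTI.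
by apply: (mf measurableT [set (c k)%:R]); exact: measurable_set1.
Qed.

Let K_gt0 : (0 < K)%N.
Proof. by move: T0; rewrite TE pmulr_lgt0// ltr0n. Qed.

Let bin_inj k k' x : bin k x -> bin k' x -> k = k'.
Proof.
rewrite /bin /= !in_itv /= => /andP[kx xk] /andP[k'x xk'].
have := le_lt_trans kx xk'; have := le_lt_trans k'x xk.
by rewrite !ltr_pM2r// !ltr_nat !ltnS => ? ?; apply/eqP; rewrite eqn_leq; apply/andP.
Qed.

Let bin_truncn x : 0 <= x < T ->
  (Num.truncn (x / h) < K)%N /\ bin (Num.truncn (x / h)) x.
Proof.
move=> /andP[x0 xT]; have xh0 : 0 <= x / h by rewrite divr_ge0// ltW.
split; first by rewrite truncn_lt_nat// ltr_pdivrMr// -TE.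
rewrite /bin /= in_itv /= -ler_pdivlMr// -ltr_pdivrMr//.
by rewrite -truncn_ge_nat// leqnn -truncn_le_nat leqnn.
Qed.

(** Off a null set, prescribing the increments amounts to prescribing which
    point falls where, up to the ways of distributing the points that give these
    counts; the number of points is then forced to be the total count. *)
Let increments_event_blocks i (c : 'I_K -> nat) w : good i w ->
  increments_event T h U xi b i c w <->
  (\bigcup_(t : {t | t \in has_counts (\sum_k c k)%N c})
     block_event i [seq val k | k <- val t]) w.
Proof.
move=> [[z _ wz] wxi]; split.
  move=> H.
  have kP p : (Num.truncn (xi' i p w / h) < K)%N /\
      bin (Num.truncn (xi' i p w / h)) (xi' i p w) by exact: bin_truncn.
  pose t := [tuple Ordinal (kP p).1 | p < z].
  have tc k : count_mem k t = c k.
    apply/eqP; rewrite -(eqr_nat R) -(H k) antithetic_incrementE (antithetic_countE wz).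
    rewrite -sum1_count big_tuple big_mkcond natr_sum; apply/eqP; apply: eq_bigr => p _.
    rewrite tnth_mktuple indicE /= -(inj_eq val_inj) /=; case: eqP => [<-|Nk].
      by rewrite mem_set//; exact: (kP p).2.
    by rewrite memNset// => /(bin_inj (kP p).2).
  have zE : (\sum_k c k)%N = z.
    transitivity (\sum_k \sum_(j <- t) (j == k : nat))%N.
      apply: eq_bigr => k _; rewrite -tc -sum1_count big_mkcond.
      by apply: eq_bigr => j _ /=; case: eqP.
    rewrite exchange_big /= (eq_bigr (fun=> 1%N)) => [|j _].
      by rewrite sum1_size size_tuple card_ord.
    by rewrite (bigD1 j)//= eqxx big1 // => k /negbTE; rewrite eq_sym => ->.
  move: (zE) => /esym zE'; subst z.
  have tP : t \in has_counts (\sum_k c k)%N c.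
    by rewrite inE; apply/forallP => k; rewrite tc.
  exists (exist _ t tP) => //=; rewrite /block_event /=.
  rewrite size_map size_tuple ?card_ord; split => // p pz.
  rewrite (nth_map (Ordinal (kP p).1)) ?size_tuple ?card_ord//.
  have -> : nth (Ordinal (kP p).1) t p = tnth t (Ordinal pz).
    by rewrite (tnth_nth (Ordinal (kP p).1)).
  by rewrite tnth_mktuple /=; exact: (kP p).2.
move=> [[t tP] _ /= [wz' wt]] k.
rewrite antithetic_incrementE (antithetic_countE wz') size_map size_tuple.
have /forallP/(_ k)/eqP <- : [forall k, count_mem k t == c k] by rewrite inE in tP.
rewrite -sum1_count big_tuple natr_sum [RHS]big_mkcond; apply: eq_bigr => p _.
have := wt p; rewrite size_map size_tuple => /(_ (ltn_ord p)).
rewrite (nth_map (tnth t p)) ?size_tuple// -tnth_nth => wp.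
rewrite indicE /= -(inj_eq val_inj) /=; case: eqP => [<-|Nk]; first by rewrite mem_set.
by rewrite memNset// => /(bin_inj wp).
Qed.

(** Poisson splitting: a Poisson number of points thrown uniformly into K cells
    gives independent Poisson counts, since the factorial of the total cancels
    against the multinomial coefficient. *)
Let multinomial_pois i (c : 'I_K -> nat) :
  #|has_counts (\sum_k c k)%N c|%:R *
    (pois (lam i) (\sum_k c k)%N * K%:R^-1 ^+ (\sum_k c k)%N) =
  \prod_(k < K) pois (rate i.1 * h) (c k).
Proof.
have K0 : K%:R != 0 :> R by rewrite pnatr_eq0 -lt0n.
have lamE : lam i = K%:R * (rate i.1 * h) by rewrite /lam TE; ring.
rewrite /pois !big_split /= prodrXr.
have -> : \prod_(k < K) expR (- (rate i.1 * h)) = expR (- lam i).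
  by rewrite prodr_const card_ord -expRM_natl lamE mulrN.
have cN0 : (\prod_k (c k)`!)%:R != 0 :> R.
  by rewrite pnatr_eq0 -lt0n prodn_gt0// => k; exact: fact_gt0.
have zN0 : (\sum_k c k)%N`!%:R != 0 :> R by rewrite pnatr_eq0 -lt0n fact_gt0.
have /(congr1 (fun x => x%:R : R)) := card_has_counts (erefl (\sum_k c k)%N).
rewrite natrM prodfV -natr_prod => NE.
move: zN0; rewrite -NE mulf_eq0 negb_or => /andP[NN0 _].
rewrite lamE exprMn exprVn; field.
by rewrite NN0 cN0 expf_neq0.
Qed.

(** Up to a null set each event is a disjoint union of blocks of the input
    variables, so the two grouping lemmas give independence over channels and
    pairs, and Poisson splitting gives each factor. *)
Theorem antithetic_increments_law (s : seq (channel G * 'I_M))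
    (c : channel G * 'I_M -> 'I_K -> nat) :
  uniq s ->
  P (\bigcap_(i in [set` s]) increments_event T h U xi b i (c i)) =
  (\prod_(i <- s) \prod_(k < K) pois (rate i.1 * h) (c i k))%:E.
Proof.
move=> us.
pose D i := \bigcup_(t : {t | t \in has_counts (\sum_k c i k)%N (c i)})
     block_event i [seq val k | k <- val t].
have mB i t : measurable (block_event i t).
  by apply: blocks_meas; exact: blocks_block_event.
have tD i : trivIset setT (fun t : {t | t \in has_counts (\sum_k c i k)%N (c i)} =>
    block_event i [seq val k | k <- val t]).
  move=> t t' _ _ [w [[_ wt] [_ wt']]]; apply: val_inj; apply: val_inj => /=.
  apply: (inj_map val_inj); apply: (@eq_from_nth _ 0%N) => [|p].
    by rewrite !size_map !size_tuple.
  move=> pt; apply: (bin_inj (wt p pt)); apply: wt'.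
  by rewrite !size_map !size_tuple in pt *.
have du i : disjoint_unions (blocks F blk) i (D i).
  by exists _, (fun t : {t | t \in has_counts (\sum_k c i k)%N (c i)} =>
    block_event i [seq val k | k <- val t]); split => [|t|//];
    [exact: tD|exact: blocks_block_event].
have PD i : P (D i) = (\prod_(k < K) pois (rate i.1 * h) (c i k))%:E.
  rewrite [LHS](measure_finType_bigcup P (tD i))//.
  transitivity (\sum_(t : {t | t \in has_counts (\sum_k c i k)%N (c i)})
    (pois (lam i) (\sum_k c i k)%N * K%:R^-1 ^+ (\sum_k c i k)%N)%:E)%E.
    apply: eq_bigr => t _; rewrite [LHS]P_block_event ?size_map ?size_tuple//.
    by apply/allP => _ /mapP[k _ ->] /=.
  by rewrite sumEFin sumr_const card_sig -multinomial_pois mulr_natl.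
have mD i : measurable (D i) by apply: fin_bigcup_measurable => // t _.
transitivity (P (\bigcap_(i in [set` s]) D i)).
  apply: eq_ae_measure.
  - apply: fin_bigcap_measurable => [|i _]; first exact: finite_seq.
    exact: measurable_increments_event.
  - by apply: fin_bigcap_measurable => [|i _]; [exact: finite_seq|exact: mD].
  - apply: filterS good_ae => w gw; split => H i /H;
      by move/(increments_event_blocks (c i) (gw i)).
have indB : mutually_independent P (blocks F blk).
  by apply: mutually_independent_blocks; case: inp.
rewrite (mutually_independent_disjoint_unions blocks_meas indB us)//.
by congr EFin; apply: eq_bigr => i _; rewrite PD.
Qed.

End antithetic_law.

(** * Law of the increments of the driver *)

Section driver_law.
Context (R : realType) (n : nat) (G : network R n).
Context d (Omega : measurableType d) (P : probability Omega R).
Context (J : channel G -> R -> Omega -> nat) (h : R) (K : nat).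
Hypotheses (h0 : 0 < h) (drv : independent_poisson_driver P J).

Let count_event (c : channel G -> 'I_K -> nat) (a : channel G) : set Omega :=
  [set w | forall k : 'I_K, (J a (k.+1%:R * h) w - J a (k%:R * h) w)%N = c a k].

Let kh_ge0 k : 0 <= k%:R * h. Proof. by rewrite mulr_ge0// ltW. Qed.

Let kh_le k : k%:R * h <= k.+1%:R * h.
Proof. by rewrite ler_pM2r// ler_nat. Qed.

Lemma driver_incrementE w (k : nat) a :
  driver_increment J h w k a = (J a (k.+1%:R * h) w - J a (k%:R * h) w)%N%:R.
Proof.
by have [_ _ /(_ w)[/(_ _ _ (kh_ge0 k) (kh_le k)) le _] _ _] := drv.1 a; rewrite natrB.
Qed.

(** Phrased as membership in the sigma-algebra of one process, since
    independence of the processes is stated for these sigma-algebras. *)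
Let sigma_count_event c a : sigma_process (J a) (count_event c a).
Proof.
pose S := \bigcup_(t in [set t : R | 0 <= t]) sigma_rv (J a t).
have mJ t x : 0 <= t ->
    measurable ([set w | J a t w = x] : set (g_sigma_algebraType S)).
  move=> t0; apply: sub_sigma_algebra; exists t => //; exists [set x] => //.
  by rewrite setTI.
have -> : count_event c a = \bigcap_(k in [set: 'I_K])
    \bigcup_x ([set w | J a (k%:R * h) w = x] `&`
      \bigcup_(y in [set y | (y - x)%N = c a k]) [set w | J a (k.+1%:R * h) w = y]).
  apply/seteqP; split => w /=.
    by move=> H k _; exists (J a (k%:R * h) w) => //; split=> //;
      exists (J a (k.+1%:R * h) w) => //=; exact: H.
  by move=> H k; have [x _ [/= -> [y /= <- ->]]] := H k I.
suff : measurable ((\bigcap_(k in [set: 'I_K])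
    \bigcup_x ([set w | J a (k%:R * h) w = x] `&`
      \bigcup_(y in [set y | (y - x)%N = c a k]) [set w | J a (k.+1%:R * h) w = y]))
   : set (g_sigma_algebraType S)) by [].
apply: fin_bigcap_measurable => // k _; apply: bigcupT_measurable => x.
apply: measurableI; first exact: mJ.
by apply: bigcup_measurable => y _; exact: mJ.
Qed.

Theorem driver_increments_law (c : channel G -> 'I_K -> nat) :
  P [set w | forall (k : 'I_K) a, driver_increment J h w k a = (c a k)%:R] =
  (\prod_a \prod_(k < K) pois (rate a * h) (c a k))%:E.
Proof.
have -> : [set w | forall (k : 'I_K) a, driver_increment J h w k a = (c a k)%:R] =
    \bigcap_(a in [set` index_enum (channel G)]) count_event c a.
  apply/seteqP; split => w /= H.
    by move=> a _ k; apply/eqP; rewrite -(eqr_nat R) -driver_incrementE H.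
  by move=> k a; rewrite driver_incrementE (H a _ k)//= mem_index_enum.
rewrite drv.2; [|exact: index_enum_uniq|by move=> a _; exact: sigma_count_event].
congr EFin; apply: eq_bigr => a _.
have [mJ _ _ lawJ indJ] := drv.1 a.
have -> : count_event c a = \bigcap_(k in [set` index_enum 'I_K])
    [set w | (J a (k.+1%:R * h) w - J a (k%:R * h) w)%N = c a k].
  apply/seteqP; split => w /= H k; first by move=> _; exact: H.
  by apply: H => /=; rewrite mem_index_enum.
rewrite (indJ K (fun k => k%:R * h)); first last.
- by move=> k _; exists [set c a k] => //; rewrite setTI.
- exact: index_enum_uniq.
- exact: kh_le.
- exact: kh_ge0.
apply: eq_bigr => k _.
have := lawJ (k%:R * h) (k.+1%:R * h) [set c a k] (kh_ge0 k) (kh_le k).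
rewrite poisson_prob_set1; last first.
  by rewrite mulr_ge0 ?rate_ge0// subr_ge0 kh_le.
rewrite -mulrBl -natrB// subSnn mul1r => /(congr1 fine) /= <-.
by [].
Qed.

End driver_law.

(** * Expectations of integer-valued variables *)

Section discrete_law.
Context (R : realType).

Lemma bigcup_of_set1 (A : set nat) : \bigcup_(x in A) [set x] = A.
Proof. by rewrite bigcup_imset1 image_id. Qed.

Lemma eq_measure_nat (m1 m2 : {measure set nat -> \bar R}) :
  (forall x, m1 [set x] = m2 [set x]) -> forall A, m1 A = m2 A.
Proof.
move=> m12 A; rewrite -(bigcup_of_set1 A).
rewrite !measure_bigcup//; last 2 first.
- by move=> x y _ _ [z [-> ->]].
- by move=> x y _ _ [z [-> ->]].
by apply: eq_eseriesr => x _; exact: m12.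
Qed.

Lemma measurable_fun_nat d (Omega : measurableType d) (X : Omega -> nat) :
  (forall x, measurable (X @^-1` [set x])) -> measurable_fun setT X.
Proof.
move=> mX _ A _; rewrite setTI -(bigcup_of_set1 A) preimage_bigcup.
by apply: bigcup_measurable => x _; exact: mX.
Qed.

Section transfer.
Context d (Omega : measurableType d) (P : probability Omega R).
Context d' (Omega' : measurableType d') (P' : probability Omega' R).

(** The positive parts have equal integrals, and so have the negative parts,
    whether finite or not. *)
Lemma expectation_eq_law (X : {RV P >-> nat}) (X' : {RV P' >-> nat}) (f : nat -> R) :
  (forall x, P (X @^-1` [set x]) = P' (X' @^-1` [set x])) ->
  ('E_P[f \o X] = 'E_P'[f \o X'])%E.
Proof.
move=> XX'.
have eqI (F : nat -> \bar R) : (forall x, 0 <= F x)%E ->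
    (\int[P]_w F (X w) = \int[P']_w F (X' w))%E.
  move=> F0.
  rewrite -(ge0_integral_distribution X)// -(ge0_integral_distribution X')//.
  apply: eq_measure_integral => A mA _; exact: eq_measure_nat.
rewrite unlock [LHS]integralE [RHS]integralE; congr (_ - _)%E.
- have := eqI (fun x => (EFin \o f)^\+ x)%E (funepos_ge0 _).
  by rewrite -[X in integral _ _ X = _](funepos_comp (EFin \o f) X)
    -[X in _ = integral _ _ X](funepos_comp (EFin \o f) X').
- have := eqI (fun x => (EFin \o f)^\- x)%E (funeneg_ge0 _).
  by rewrite -[X in integral _ _ X = _](funeneg_comp (EFin \o f) X)
    -[X in _ = integral _ _ X](funeneg_comp (EFin \o f) X').
Qed.

End transfer.

Section product.
Context d (Omega : measurableType d) (P : probability Omega R).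
Context (X Y : {RV P >-> nat}) (f g : nat -> R).
Hypothesis XY : forall x y, P (X @^-1` [set x] `&` Y @^-1` [set y]) =
  (P (X @^-1` [set x]) * P (Y @^-1` [set y]))%E.

(** Independence of the values extends to arbitrary sets of values by
    countable additivity in each argument. *)
Let independent_preimages A B :
  P (X @^-1` A `&` Y @^-1` B) = (P (X @^-1` A) * P (Y @^-1` B))%E.
Proof.
have mX C : measurable (X @^-1` C).
  by rewrite -[X in measurable X]setTI; apply: measurable_funPT.
have mY C : measurable (Y @^-1` C).
  by rewrite -[X in measurable X]setTI; apply: measurable_funPT.
have split_event (Z : {RV P >-> nat}) (D : set nat) C : measurable C ->
    P (Z @^-1` D `&` C) = (\sum_(x <oo | x \in D) P (Z @^-1` [set x] `&` C))%E.
  move=> mC; rewrite -[in LHS](bigcup_of_set1 D) preimage_bigcup setI_bigcupl.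
  rewrite measure_bigcup//.
  - move=> x _; apply: measurableI => //.
    by rewrite -[X in measurable X]setTI; apply: measurable_funPT.
  - by move=> x y _ _ [w [[/= <- _] [/= <- _]]].
have XB x : P (X @^-1` [set x] `&` Y @^-1` B) =
    (P (X @^-1` [set x]) * P (Y @^-1` B))%E.
  rewrite setIC split_event//.
  rewrite (eq_eseriesr (g := fun y => (P (X @^-1` [set x]) * P (Y @^-1` [set y]))%E)).
    have /fineK <- : P (X @^-1` [set x]) \is a fin_num by exact: fin_num_measure.
    rewrite nneseriesZl//; congr (_ * _)%E.
    rewrite -[in RHS](setIT (Y @^-1` B)) split_event//.
    by apply: eq_eseriesr => y _; rewrite setIT.
  by move=> y _; rewrite setIC XY.
rewrite split_event//.
rewrite (eq_eseriesr (g := fun x => (P (Y @^-1` B) * P (X @^-1` [set x]))%E)).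
  have /fineK <- : P (Y @^-1` B) \is a fin_num by exact: fin_num_measure.
  rewrite nneseriesZl// muleC; congr (_ * _)%E.
  rewrite -[in RHS](setIT (X @^-1` A)) split_event//.
  by apply: eq_eseriesr => y _; rewrite setIT.
by move=> x _; rewrite XB muleC.
Qed.

(** The joint law is the product of the marginal laws, so Fubini applies. *)
Lemma expectation_prod_independent :
  P.-integrable setT (EFin \o (f \o X)) ->
  P.-integrable setT (EFin \o (g \o Y)) ->
  P.-integrable setT (fun w => (f (X w) * g (Y w))%:E) ->
  ('E_P[fun w => (f (X w) * g (Y w))%R] = 'E_P[f \o X] * 'E_P[g \o Y])%E.
Proof.
move=> iX iY iXY; rewrite unlock.
have mXY : measurable_fun setT (fun w => (X w, Y w)) by exact: measurable_fun_pair.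
(* Bundled, so that its law is recognised as a probability. *)
pose XYc := isMeasurableFun.Build _ _ _ _ _ mXY.
pose Z : {RV P >-> (nat * nat)%type} := HB.pack (fun w => (X w, Y w)) XYc.
pose F (p : nat * nat) : \bar R := (f p.1 * g p.2)%:E.
have mF : measurable_fun setT F.
  apply/measurable_EFinP; apply: measurable_funM.
    exact: (measurableT_comp (f := f)).
  exact: (measurableT_comp (f := g)).
pose dX := distribution P X; pose dY := distribution P Y.
have dXY A : measurable A -> (dX \x dY)%E A = distribution P Z A.
  move=> mA.
  apply: (@product_measure_unique _ _ _ _ _ (distribution P X) (distribution P Y)
    (distribution P Z) _ A mA).
  by move=> B C _ _; exact: independent_preimages.
have eqI H : (\int[dX \x dY]_p H p =
    \int[distribution P Z]_p H p)%E.
  by apply: eq_measure_integral => A mA _; exact: dXY.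
have iF : (dX \x dY)%E.-integrable setT F.
  apply/integrableP; split => //; rewrite eqI ge0_integral_distribution//.
    by have /integrableP[] := iXY.
  exact: measurableT_comp.
transitivity (\int[dX \x dY]_p F p)%E.
  by rewrite eqI integral_distribution.
rewrite -integral12_prod_meas1// /fubini_F /F /=.
have idX : dX.-integrable setT (EFin \o f) by exact: integrable_pushforward.
have idY : dY.-integrable setT (EFin \o g) by exact: integrable_pushforward.
under eq_integral do (under eq_integral do rewrite EFinM; rewrite integralZl//).
rewrite -[X in _ = (X * _)%E](@integral_distribution _ _ _ _ _ P X (EFin \o f))//.
rewrite -[X in _ = (_ * X)%E](@integral_distribution _ _ _ _ _ P Y (EFin \o g))//.
have /fineK <- : (\int[dY]_y (g y)%:E)%E \is a fin_num by exact: integrable_fin_num.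
by rewrite integralZr.
Qed.
End product.
End discrete_law.

(** * Variables with moments of all orders *)

Section moments.
Context d (Omega : measurableType d) (R : realType) (P : probability Omega R).
Implicit Types X Y : Omega -> R.

(** These variables form an algebra, so every polynomial in Poisson counts has
    moments of all orders without any computation of degrees. *)
Definition all_moments X : Prop :=
  measurable_fun setT X /\
  forall p, P.-integrable setT (fun w => (`|X w| ^+ p)%:E).

Lemma all_moments_le X Y p : measurable_fun setT X ->
  P.-integrable setT (fun w => (Y w)%:E) -> (forall w, `|X w| ^+ p <= Y w) ->
  P.-integrable setT (fun w => (`|X w| ^+ p)%:E).
Proof.
move=> mX iY XY; apply: (le_integrable measurableT _ _ iY) => [|w _].
  by apply/measurable_EFinP; apply: measurable_funX; exact: measurableT_comp.
by rewrite /= lee_fin normrX normr_id (le_trans (XY w))// ler_norm.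
Qed.

Lemma all_moments_integrable X : all_moments X -> P.-integrable setT (EFin \o X).
Proof.
move=> [mX /(_ 1%N) iX]; apply: (le_integrable measurableT _ _ iX).
  exact/measurable_EFinP.
by move=> w _; rewrite /= lee_fin expr1 normr_id.
Qed.

Lemma all_moments_cst (c : R) : all_moments (fun=> c).
Proof.
split=> [|p]; first exact: measurable_cst.
exact: finite_measure_integrable_cst.
Qed.

Lemma all_momentsD X Y : all_moments X -> all_moments Y ->
  all_moments (fun w => X w + Y w).
Proof.
move=> [mX iX] [mY iY]; have mXY := measurable_funD mX mY.
split=> // p.
apply: (@all_moments_le _ (fun w => 2 ^+ p * (`|X w| ^+ p + `|Y w| ^+ p))) => //.
  under eq_fun do rewrite EFinM EFinD.
  by apply: integrableZl => //; exact: integrableD.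
move=> w; have := ler_normD (X w) (Y w).
have X0 := normr_ge0 (X w); have Y0 := normr_ge0 (Y w).
have [XY|YX] := leP `|X w| `|Y w| => H.
  apply: (@le_trans _ _ ((2 * `|Y w|) ^+ p)); first by rewrite lerXn2r ?nnegrE//; lra.
  by rewrite exprMn ler_pM2l ?exprn_gt0// lerDr exprn_ge0.
apply: (@le_trans _ _ ((2 * `|X w|) ^+ p)); first by rewrite lerXn2r ?nnegrE//; lra.
by rewrite exprMn ler_pM2l ?exprn_gt0// lerDl exprn_ge0.
Qed.

Lemma all_momentsM X Y : all_moments X -> all_moments Y ->
  all_moments (fun w => X w * Y w).
Proof.
move=> [mX iX] [mY iY]; have mXY := measurable_funM mX mY.
split=> // p.
apply: (@all_moments_le _ (fun w => `|X w| ^+ (p * 2) + `|Y w| ^+ (p * 2))) => //.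
  by under eq_fun do rewrite EFinD; exact: integrableD.
move=> w; rewrite normrM exprMn !exprM.
set x := _ ^+ p; set y := _ ^+ p.
have := sqr_ge0 (x - y); have := sqr_ge0 x; have := sqr_ge0 y; nra.
Qed.

Lemma all_moments_sum (I : Type) (s : seq I) (X : I -> Omega -> R) :
  (forall i, all_moments (X i)) -> all_moments (fun w => \sum_(i <- s) X i w).
Proof.
move=> mX; elim: s => [|i s IH].
  under eq_fun do rewrite big_nil; exact: all_moments_cst.
by under eq_fun do rewrite big_cons; exact: all_momentsD.
Qed.

Lemma all_momentsN X : all_moments X -> all_moments (fun w => - X w).
Proof.
move=> mX; under eq_fun do rewrite -mulN1r.
exact: all_momentsM (all_moments_cst _) mX.
Qed.

Lemma all_momentsB X Y : all_moments X -> all_moments Y ->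
  all_moments (fun w => X w - Y w).
Proof. by move=> mX mY; apply: all_momentsD => //; exact: all_momentsN. Qed.

Lemma all_momentsX X p : all_moments X -> all_moments (fun w => X w ^+ p).
Proof.
move=> mX; elim: p => [|p IH].
  under eq_fun do rewrite expr0; exact: all_moments_cst.
by under eq_fun do rewrite exprS; exact: all_momentsM.
Qed.

(** Raise k/p <= exp(k/p) to the power p. *)
Lemma exprn_le_expR (p k : nat) : k%:R ^+ p <= p%:R ^+ p * expR 1 ^+ k :> R.
Proof.
case: p => [|p]; first by rewrite !expr0 mul1r exprn_ege1// -expR0 ler_expR.
have p0 : 0 < p.+1%:R :> R by rewrite ltr0n.
have -> : expR 1 ^+ k = expR (k%:R / p.+1%:R) ^+ p.+1 :> R.
  by rewrite -!expRM_natl; congr expR; field; rewrite gt_eqF.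
rewrite -exprMn lerXn2r ?nnegrE ?mulr_ge0 ?expR_ge0//.
rewrite mulrC -ler_pdivrMr//; apply: le_trans (expR_ge1Dx _).
by rewrite lerDr.
Qed.

(** Bounding k^p by p^p e^k turns the Poisson weights of rate r into a constant
    multiple of those of rate e r, whose sum is 1. *)
Lemma all_moments_poisson (N : Omega -> nat) (r : R) : 0 <= r ->
  measurable_fun setT N -> (forall k, P (N @^-1` [set k]) = (pois r k)%:E) ->
  all_moments (fun w => (N w)%:R).
Proof.
move=> r0 mN NE.
have mNR : measurable_fun setT (fun w => (N w)%:R : R).
  by apply: (measurableT_comp (f := fun n : nat => n%:R : R)).
split => // p; apply/integrableP; split.
  by apply/measurable_EFinP; apply: measurable_funX; exact: measurableT_comp.
have mNk k : measurable (N @^-1` [set k]).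
  by rewrite -[X in measurable X]setTI; exact: mN.
have -> : [set: Omega] = \bigcup_k N @^-1` [set k].
  by apply/seteqP; split => // w _; exists (N w).
rewrite ge0_integral_bigcup//; last 2 first.
- apply: measurable_funTS; apply: measurableT_comp => //.
  by apply/measurable_EFinP; apply: measurable_funX; exact: measurableT_comp.
- by move=> k l _ _ [w [/= <- <-]].
have e1 : 0 <= expR 1 * r by rewrite mulr_ge0// expR_ge0.
set c : R := p%:R ^+ p * expR (expR 1 * r - r).
have c0 : 0 <= c by rewrite mulr_ge0// ?expR_ge0// exprn_ge0.
apply: (@le_lt_trans _ _ (\sum_(k <oo) c%:E * poisson_prob (expR 1 * r) 0 [set k])%E).
  apply: lee_nneseries => [k _ _|k _]; first by apply: integral_ge0.
  rewrite (eq_integral (fun=> (k%:R ^+ p)%:E)); last first.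
    by move=> w; rewrite inE /= => ->; rewrite !normrX !normr_nat.
  rewrite integral_cst// [X in (_ * X <= _)%E]NE poisson_prob_set1// -!EFinM lee_fin.
  rewrite (@le_trans _ _ (p%:R ^+ p * expR 1 ^+ k * pois r k))//.
    by rewrite ler_wpM2r ?pois_ge0// exprn_le_expR.
  rewrite le_eqVlt /c /pois expRB exprMn; apply/orP; left; apply/eqP.
  rewrite expRN expRN; field.
  by rewrite !gt_eqF ?expR_gt0// ltr0n fact_gt0.
rewrite nneseriesZl//.
have -> : (\sum_(k <oo) poisson_prob (expR 1 * r) 0 [set k] = 1)%E.
  rewrite -(probability_setT (poisson_prob (expR 1 * r) 0)).
  have -> : [set: nat] = \bigcup_k [set k] by apply/seteqP; split => // k _; exists k.
  by rewrite measure_semi_bigcup// => k l _ _ [z [-> ->]].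
by rewrite mule1 ltry.
Qed.

End moments.

(** * Moments and encoding of a trajectory *)

Section scheme_moments.
Context (R : realType) (n : nat) (G : network R n).
Context d (Omega : measurableType d) (P : probability Omega R).

Lemma all_moments_coef (x : Omega -> 'cV[R]_n) :
  (forall j, all_moments P (fun w => x w j 0)) ->
  forall j (a : channel G), all_moments P (fun w => coef (x w) j a).
Proof.
move=> mx j [i|e]; rewrite /coef.
  by case: (i == j); [exact: all_momentsN|exact: all_moments_cst].
case: (_ == j); last exact: all_moments_cst.
by apply: all_momentsM => //; apply: all_momentsB => //; exact: all_moments_cst.
Qed.

Lemma all_moments_coef_mul (c : Omega -> 'I_n -> channel G -> R)
    (v : Omega -> channel G -> R) :
  (forall j a, all_moments P (fun w => c w j a)) ->
  (forall a, all_moments P (v ^~ a)) ->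
  forall j, all_moments P (fun w => coef_mul (c w) (v w) j 0).
Proof.
move=> mc mv j; under eq_fun do rewrite mxE.
apply: all_moments_sum => a /=.
exact: (@all_momentsM _ _ _ P (fun w => c w j a) (v ^~ a)).
Qed.

(** A step of either scheme is polynomial in the state and the increments. *)
Lemma all_moments_scheme_step (sch : scheme) (x : Omega -> 'cV[R]_n)
    (v : Omega -> channel G -> R) :
  (forall j, all_moments P (fun w => x w j 0)) ->
  (forall a, all_moments P (v ^~ a)) ->
  forall j, all_moments P (fun w => scheme_step sch (x w) (v w) j 0).
Proof.
move=> mx mv; pose y w := x w + coef_mul (coef (x w)) (v w).
have mc := all_moments_coef mx.
have my j : all_moments P (fun w => y w j 0).
  under eq_fun do rewrite mxE.
  by apply: all_momentsD; [exact: mx|exact: all_moments_coef_mul].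
have mcy := all_moments_coef my.
case: sch => j; rewrite /scheme_step; first exact: my.
under eq_fun do rewrite mxE [in X in _ + X]mxE.
apply: all_momentsD; first exact: my.
apply: all_momentsM; first exact: all_moments_cst.
apply: all_moments_coef_mul => [i|] a; first exact: all_momentsB.
by apply: all_momentsM => //; apply: all_momentsB => //; exact: all_moments_cst.
Qed.

Lemma all_moments_scheme_run (sch : scheme) (v : Omega -> nat -> channel G -> R) :
  (forall k a, all_moments P (fun w => v w k a)) ->
  forall k j, all_moments P (fun w => scheme_run sch (v w) k j 0).
Proof.
move=> mv; elim => [|k IH] j /=; last by apply: all_moments_scheme_step.
by under eq_fun do rewrite mxE; exact: all_moments_cst.
Qed.

Lemma all_moments_driver (J : channel G -> R -> Omega -> nat) (h : R) :
  0 < h -> independent_poisson_driver P J ->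
  forall k a, all_moments P (fun w => driver_increment J h w k a).
Proof.
move=> h0 drv k a.
have kh0 i : 0 <= i%:R * h by rewrite mulr_ge0// ltW.
have kh1 : k%:R * h <= k.+1%:R * h by rewrite ler_pM2r// ler_nat.
have [mJ _ _ lawJ _] := drv.1 a.
have mnat : measurable_fun setT (fun n : nat => n%:R : R) by [].
have mN : measurable_fun setT (fun w => driver_increment J h w k a).
  by apply: measurable_funB; apply: (measurableT_comp mnat); exact: mJ.
under eq_fun do rewrite (driver_incrementE h0 drv).
apply: (@all_moments_poisson _ _ _ _ _ (rate a * (k.+1%:R * h - k%:R * h))).
- by rewrite mulr_ge0 ?rate_ge0// subr_ge0.
- apply: measurable_fun_nat => x.
  have -> : (fun w => J a (k.+1%:R * h)%R w - J a (k%:R * h)%R w)%N @^-1` [set x] =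
      (fun w => driver_increment J h w k a) @^-1` [set x%:R].
    apply/seteqP; split => w /=; rewrite (driver_incrementE h0 drv); first by move=> ->.
    by move/eqP; rewrite eqr_nat => /eqP.
  by rewrite -[X in measurable X]setTI; exact: mN.
- move=> x; rewrite (lawJ _ _ [set x])// poisson_prob_set1//.
  by rewrite mulr_ge0 ?rate_ge0// subr_ge0.
Qed.

End scheme_moments.

Section increment_code.
Context (R : realType) (n : nat) (G : network R n) (K : nat).
Let D := {ffun channel G * 'I_K -> nat}.

Lemma eq_scheme_run (sch : scheme) (v v' : nat -> channel G -> R) :
  (forall (k : 'I_K) a, v k a = v' k a) -> scheme_run sch v K = scheme_run sch v' K.
Proof.
move=> vv'; have : (K <= K)%N by [].
elim: {1 3 4}K => [//|k IH] kK /=; rewrite IH; last exact: ltnW.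
by congr scheme_step; apply/funext => a; exact: (vv' (Ordinal kK)).
Qed.

(** A trajectory of K steps uses finitely many integers, hence one natural
    number.  This reduces laws of trajectories to laws on nat, where every
    function is measurable. *)
Definition increment_code (v : nat -> channel G -> R) : nat :=
  pickle [ffun p : channel G * 'I_K => Num.truncn (v p.2 p.1)].

Definition increment_decode (x : nat) (k : nat) (a : channel G) : R :=
  if unpickle x is Some c then
    if insub k is Some k' then ((c : D) (a, k'))%:R else 0
  else 0.

Definition nat_increments (v : nat -> channel G -> R) :=
  forall k a, v k a \is a Num.nat.

Lemma scheme_run_code (sch : scheme) (v : nat -> channel G -> R) :
  nat_increments v ->
  scheme_run sch (increment_decode (increment_code v)) K = scheme_run sch v K.
Proof.
move=> nv; apply: eq_scheme_run => k a.
by rewrite /increment_decode pickleK valK ffunE /= truncnK.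
Qed.

(** The preimage of a code is empty when the code is not taken, and otherwise
    prescribes all increments. *)
Lemma increment_codeE (x : nat) :
  (exists c : channel G -> 'I_K -> nat, forall v, nat_increments v ->
    increment_code v = x <-> forall k a, v (k : 'I_K) a = (c a k)%:R) \/
  (forall v, increment_code v <> x).
Proof.
have [[c cx]|xN] := pselect (exists c : D, pickle c = x); last first.
  by right=> v vx; apply: xN; eexists; exact: vx.
left; exists (fun a k => c (a, k)) => v nv; rewrite -cx; split.
  move=> /(pcan_inj pickleK) <- k a; by rewrite ffunE /= truncnK.
move=> vc; congr pickle; apply/ffunP => -[a k]; rewrite ffunE /= vc.
exact: natrK.
Qed.

Section law.
Context d (Omega : measurableType d) (P : probability Omega R).
Context (v : Omega -> nat -> channel G -> R).
Hypothesis nv : forall w, nat_increments (v w).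
Let event c := [set w | forall (k : 'I_K) a, v w k a = (c a k)%:R].

Lemma measurable_increment_code : (forall c, measurable (event c)) ->
  measurable_fun setT (fun w => increment_code (v w)).
Proof.
move=> mE; apply: measurable_fun_nat => x.
have [[c cx]|xN] := increment_codeE x.
  suff -> : (fun w => increment_code (v w)) @^-1` [set x] = event c by exact: mE.
  by apply/seteqP; split => w /cx; exact.
suff -> : (fun w => increment_code (v w)) @^-1` [set x] = set0 by exact: measurable0.
by apply/seteqP; split => w //= /xN.
Qed.

Lemma increment_code_law d' (Omega' : measurableType d') (P' : probability Omega' R)
    (v' : Omega' -> nat -> channel G -> R) :
  (forall w, nat_increments (v' w)) ->
  (forall c, P (event c) = P' [set w | forall (k : 'I_K) a, v' w k a = (c a k)%:R]) ->
  forall x, P ((fun w => increment_code (v w)) @^-1` [set x]) =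
            P' ((fun w => increment_code (v' w)) @^-1` [set x]).
Proof.
move=> nv' PP' x; have [[c cx]|xN] := increment_codeE x.
  rewrite (_ : _ @^-1` _ = event c).
    rewrite PP'; congr (P' _); apply/seteqP.
    by split => w /= H; apply/(cx (v' w) (nv' w)).
  by apply/seteqP; split => w /= H; apply/(cx (v w) (nv w)).
rewrite (_ : _ @^-1` _ = set0); last by apply/seteqP; split => w //= /xN.
rewrite (_ : _ @^-1` _ = set0); last by apply/seteqP; split => w //= /xN.
by rewrite !measure0.
Qed.

Lemma increment_code_independent (v' : Omega -> nat -> channel G -> R) :
  (forall w, nat_increments (v' w)) ->
  let event' c := [set w | forall (k : 'I_K) a, v' w k a = (c a k)%:R] in
  (forall c c', P (event c `&` event' c') = (P (event c) * P (event' c'))%E) ->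
  forall x y, P ((fun w => increment_code (v w)) @^-1` [set x] `&`
                 (fun w => increment_code (v' w)) @^-1` [set y]) =
              (P ((fun w => increment_code (v w)) @^-1` [set x]) *
               P ((fun w => increment_code (v' w)) @^-1` [set y]))%E.
Proof.
move=> nv' event' indE x y.
have [[c cx]|xN] := increment_codeE x; last first.
  rewrite (_ : _ @^-1` [set x] = set0); last by apply/seteqP; split => w //= /xN.
  by rewrite set0I measure0 mul0e.
have [[c' cy]|yN] := increment_codeE y; last first.
  rewrite (_ : _ @^-1` [set y] = set0); last by apply/seteqP; split => w //= /yN.
  by rewrite setI0 measure0 mule0.
rewrite (_ : _ @^-1` [set x] = event c); last first.
  by apply/seteqP; split => w /= H; apply/(cx (v w) (nv w)).
rewrite (_ : _ @^-1` [set y] = event' c')//.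
by apply/seteqP; split => w /= H; apply/(cy (v' w) (nv' w)).
Qed.

End law.
End increment_code.

(** * Functions of polynomial growth *)

Section growth.
Context (R : realType) (n : nat).
Implicit Types (f g : 'cV[R]_n -> R) (x : 'cV[R]_n).

Lemma enorm_ge0 x : 0 <= enorm x. Proof. exact: sqrtr_ge0. Qed.

Lemma expr_le1D (y : R) (s t : nat) : 0 <= y -> (s <= t)%N -> y ^+ s <= 1 + y ^+ t.
Proof.
move=> y0 st; have [y1|y1] := leP y 1.
  by rewrite (le_trans (exprn_ile1 _ y0 y1))// lerDl exprn_ge0.
by rewrite (le_trans (ler_weXn2l (ltW y1) st))// lerDr.
Qed.

Lemma poly_growthP f : poly_growth f ->
  exists2 C : R, 0 <= C & exists s, forall x, `|f x| <= C * (1 + enorm x ^+ s).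
Proof.
move=> [C [s fC]]; exists `|C| => //; exists s => x; apply: le_trans (fC x) _.
by rewrite ler_wpM2r ?ler_norm// addr_ge0// exprn_ge0// enorm_ge0.
Qed.

Lemma poly_growthD f g : poly_growth f -> poly_growth g -> poly_growth (f + g).
Proof.
move=> /poly_growthP[C C0 [s fC]] /poly_growthP[D D0 [t gD]].
exists (2 * (C + D)), (s + t)%N => x; have e0 := enorm_ge0 x.
have es := expr_le1D e0 (leq_addr t s); have et := expr_le1D e0 (leq_addl s t).
have := fC x; have := gD x; have := ler_normD (f x) (g x).
have := exprn_ge0 s e0; have := exprn_ge0 t e0; have := exprn_ge0 (s + t) e0.
rewrite /=; move: (enorm x ^+ s) (enorm x ^+ t) (enorm x ^+ (s + t)) es et => u v w.
nra.
Qed.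

Lemma poly_growthM f g : poly_growth f -> poly_growth g -> poly_growth (f * g).
Proof.
move=> /poly_growthP[C C0 [s fC]] /poly_growthP[D D0 [t gD]].
exists (3 * (C * D)), (s + t)%N => x; have e0 := enorm_ge0 x.
have es := expr_le1D e0 (leq_addr t s); have et := expr_le1D e0 (leq_addl s t).
rewrite [_ x]/= normrM.
have s0 := exprn_ge0 s e0; have t0 := exprn_ge0 t e0.
apply: (le_trans (ler_pM (normr_ge0 _) (normr_ge0 _) (fC x) (gD x))).
rewrite mulrACA [in leRHS](mulrC 3) -[in leRHS]mulrA ler_wpM2l ?mulr_ge0//.
move: es et s0 t0; rewrite exprD.
by move: (enorm x ^+ s) (enorm x ^+ t) => u v; nra.
Qed.

Lemma poly_growth_ext f g : f =1 g -> poly_growth f -> poly_growth g.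
Proof. by move=> /funext->. Qed.

Let e_ (i : 'I_n) : 'cV[R]_n := delta_mx i 0.

(** The class C_P^r with f itself of polynomial growth, defined by recursion on
    the first derivative taken: the Leibniz rule then needs no combinatorics of
    multi-indices. *)
Fixpoint tame (r : nat) f : Prop :=
  [/\ continuous f, poly_growth f &
   match r with
   | 0 => True
   | r'.+1 => forall i, (forall x, derivable (f : _ -> R^o) x (e_ i)) /\
                        tame r' ('D_(e_ i) (f : _ -> R^o))
   end].

Lemma tame_growth r f : tame r f -> poly_growth f. Proof. by case: r => [|r] []. Qed.

Lemma tameS r f : tame r.+1 f -> tame r f.
Proof.
elim: r f => [|r IH] f [cf gf df]; split => // i.
by have [di ti] := df i; split=> //; exact: IH.
Qed.

Lemma tameD r f g : tame r f -> tame r g -> tame r (f + g).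
Proof.
have cD f' g' : continuous f' -> continuous g' -> continuous (f' + g' : _ -> R).
  by move=> cf cg x; apply: (@continuousD _ R^o _ f' g' x (cf x) (cg x)).
elim: r f g => [|r IH] f g [cf gf df] [cg gg dg]; split => //;
  try exact: poly_growthD; try exact: cD.
move=> i; have [dfi tfi] := df i; have [dgi tgi] := dg i; split.
  by move=> x; apply: derivableD.
have -> : 'D_(e_ i) (f + g : _ -> R^o) =
    ('D_(e_ i) (f : _ -> R^o) : _ -> R) + 'D_(e_ i) (g : _ -> R^o).
  by apply/funext => x; rewrite deriveD.
exact: IH.
Qed.

Lemma tameM r f g : tame r f -> tame r g -> tame r (f * g).
Proof.
have cM f' g' : continuous f' -> continuous g' -> continuous (f' * g' : _ -> R).
  by move=> cf cg x; apply: (@continuousM _ _ f' g' x (cf x) (cg x)).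
elim: r f g => [|r IH] f g [cf gf df] [cg gg dg]; split => //;
  try exact: poly_growthM; try exact: cM.
move=> i; have [dfi tfi] := df i; have [dgi tgi] := dg i; split.
  by move=> x; apply: derivableM.
have -> : 'D_(e_ i) (f * g : _ -> R^o) =
    (f * ('D_(e_ i) (g : _ -> R^o) : _ -> R) + g * 'D_(e_ i) (f : _ -> R^o) : _ -> R).
  by apply/funext => x; rewrite deriveM.
apply: tameD; apply: IH => //; apply: tameS; split => //.
Qed.

(** The last letter of a word is the first derivative taken. *)
Lemma partials_rcons s (i : 'I_n) f :
  partials (rcons s i) f = partials s ('D_(e_ i) (f : _ -> R^o)).
Proof. by elim: s => [//|j s IH] /=; rewrite IH. Qed.

Lemma smooth_poly_tame r f : smooth_poly r f -> poly_growth f -> tame r f.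
Proof.
elim: r f => [|r IH] f [df cf gf] g0; split => //.
- exact: (cf [::]).
- exact: (cf [::]).
move=> i; split; first exact: (df [::]).
apply: IH; last exact: (gf [:: i]).
split=> s ss; rewrite -partials_rcons; first by apply: df; rewrite size_rcons.
  by apply: cf; rewrite size_rcons.
by apply: gf; rewrite size_rcons; case/andP: ss.
Qed.

Lemma tame_smooth_poly r f : tame r f -> smooth_poly r f.
Proof.
elim: r f => [|r IH] f [cf gf df].
  by split => -[|i s] //.
split.
- case/lastP => [_ i|s i]; first exact: (df i).1.
  by rewrite size_rcons partials_rcons ltnS; have [? _ _] := IH _ (df i).2; auto.
- case/lastP => [_//|s i].
  by rewrite size_rcons partials_rcons ltnS; have [_ ? _] := IH _ (df i).2; auto.
- case/lastP => [//|s i]; rewrite size_rcons partials_rcons ltnS /= => sr.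
  have [_ _ H] := IH _ (df i).2.
  case: s sr => [_|j s sr]; first exact: tame_growth (df i).2.
  exact: H.
Qed.

(** The mean value theorem along a coordinate axis; the sign of [t] is free. *)
Lemma partial_segment f (i : 'I_n) x (t : R) :
  (forall y, derivable (f : _ -> R^o) y (e_ i)) ->
  exists2 c : R, `|c| <= `|t| &
    f (x + t *: e_ i) - f x = 'D_(e_ i) (f : _ -> R^o) (x + c *: e_ i) * t.
Proof.
move=> df; pose phi (u : R) : R := f (x + u *: e_ i).
have dphi (u : R) : is_derive u 1 phi ('D_(e_ i) (f : _ -> R^o) (x + u *: e_ i)).
  have E : (fun h : R => h^-1 *: ((phi \o shift u) (h *: (1 : R)) - phi u)) =
      (fun h : R => h^-1 *: (((f : _ -> R^o) \o shift (x + u *: e_ i)) (h *: e_ i) -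
                   f (x + u *: e_ i))).
    apply/funext => h; rewrite /phi /= /shift; congr (_ *: (f _ - _)).
    by rewrite addrCA -scalerDl /= [h%:A]mulr1.
  split; first by have := df (x + u *: e_ i); rewrite /derivable E.
  by rewrite /derive E.
have cphi (a b : R) : {within `[a, b], continuous phi}.
  apply: derivable_within_continuous => u _.
  by have [] := dphi u.
have [t0|t0] := leP 0 t.
  have [c] := MVT_segment t0 (fun u _ => dphi u) (cphi 0 t).
  rewrite in_itv /= => /andP[c0 ct] E; exists c; first by rewrite !ger0_norm.
  by move: E; rewrite /phi scale0r addr0 subr0.
have [c] := MVT_segment (ltW t0) (fun u _ => dphi u) (cphi t 0).
rewrite in_itv /= => /andP[tc c0] E; exists c.
  by rewrite (ltr0_norm t0) ler0_norm// lerN2.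
move: E; rewrite /phi scale0r addr0 sub0r mulrN => E.
by rewrite -opprB E opprK.
Qed.

Lemma enorm_le (x y : 'cV[R]_n) :
  (forall i, `|x i 0| <= `|y i 0|) -> enorm x <= enorm y.
Proof.
move=> xy; rewrite /enorm ler_wsqrtr// ler_sum// => i _.
by rewrite -[leLHS]real_normK ?num_real// -[leRHS]real_normK ?num_real// lerXn2r ?nnegrE.
Qed.

Lemma normr_le_enorm x i : `|x i 0| <= enorm x.
Proof.
rewrite /enorm -sqrtr_sqr ler_wsqrtr// (bigD1 i)//= lerDl sumr_ge0// => j _.
exact: sqr_ge0.
Qed.

(** Going from 0 to x one coordinate at a time, each step is bounded by the
    mean value theorem, and the intermediate points have norm at most that of
    x. *)
Lemma poly_growth_of_partials f :
  (forall i x, derivable (f : _ -> R^o) x (e_ i)) ->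
  (forall i, poly_growth ('D_(e_ i) (f : _ -> R^o))) -> poly_growth f.
Proof.
move=> df gf.
pose y (x : 'cV[R]_n) k : 'cV[R]_n := \col_i (if (i < k)%N then x i 0 else 0).
have yS x (k : 'I_n) : y x k.+1 = y x k + x k 0 *: e_ k.
  apply/colP => i; rewrite !mxE eqxx andbT ltnS leq_eqVlt.
  rewrite -(inj_eq val_inj) /=.
  case: eqP => [E|_] /=; last by rewrite mulr0 addr0.
  by rewrite E ltnn add0r mulr1; congr (x _ _); exact: val_inj.
have step (k : 'I_n) : poly_growth (fun x => f (y x k.+1) - f (y x k)).
  have [C C0 [s fC]] := poly_growthP (gf k).
  exists (2 * C), s.+1 => x; have [c cx E] := partial_segment (y x k) (x k 0) (df k).
  rewrite yS E normrM.
  set z := y x k + c *: e_ k.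
  have zx : enorm z <= enorm x.
    apply: enorm_le => i; rewrite !mxE eqxx andbT -(inj_eq val_inj) /=.
    case: ltnP => ik; first by rewrite (ltn_eqF ik) mulr0 addr0.
    case: eqP => [ik'|_]; last by rewrite mulr0 addr0 normr0.
    by rewrite add0r mulr1; have -> : i = k by exact: val_inj.
  apply: (le_trans (ler_pM (normr_ge0 _) (normr_ge0 _) (fC z) (normr_le_enorm x k))).
  have e0 := enorm_ge0 x.
  apply: (@le_trans _ _ (C * (1 + enorm x ^+ s) * enorm x)).
    by rewrite ler_wpM2r// ler_wpM2l// lerD2l lerXn2r ?nnegrE ?enorm_ge0.
  have := expr_le1D e0 (ltn0Sn s); rewrite expr1 exprSr.
  have := exprn_ge0 s e0; move: (enorm x ^+ s) => u u0 H.
  by nra.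
have tele k : (k <= n)%N -> poly_growth (fun x => f (y x k)).
  elim: k => [_|k IH kn].
    exists `|f 0|, 0%N => x; rewrite (_ : y x 0%N = 0); last first.
      by apply/colP => i; rewrite !mxE.
    by rewrite expr0 ler_peMr//; lra.
  apply: poly_growth_ext (poly_growthD (IH (ltnW kn)) (step (Ordinal kn))) => x /=.
  by rewrite [LHS]/= addrC subrK.
apply: poly_growth_ext (tele n (leqnn _)) => x /=; congr (f _).
by apply/colP => i; rewrite !mxE ltn_ord.
Qed.

Lemma smooth_poly_growth r f : (0 < r)%N -> smooth_poly r f -> poly_growth f.
Proof.
move=> r0 [df _ gf]; apply: poly_growth_of_partials => i.
  exact: (df [::]).
exact: (gf [:: i]).
Qed.

Lemma smooth_poly_sqr r f : (0 < r)%N -> smooth_poly r f ->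
  smooth_poly r (fun x => f x ^+ 2).
Proof.
move=> r0 sf; have tf := smooth_poly_tame sf (smooth_poly_growth r0 sf).
by apply: tame_smooth_poly; have := tameM tf tf.
Qed.

End growth.

(** * Independent pairs and the mean squared error *)

Section antithetic_pairs.
Context (R : realType) (n : nat) (G : network R n).
Context d (Omega : measurableType d) (P : probability Omega R).
Context (T h : R) (T0 : 0 < T) (M K : nat).
Context (U : channel G -> 'I_M -> {RV P >-> R}).
Context (xi : channel G -> 'I_M -> bool -> nat -> {RV P >-> R}).
Hypotheses (TE : T = K%:R * h) (h0 : 0 < h).
Hypothesis (inp : antithetic_input T0 U xi).
Implicit Types c : channel G -> 'I_K -> nat.

Let event (l : 'I_M) (b : bool) c : set Omega :=
  [set w | forall (k : 'I_K) a, antithetic_increment T h U xi l b w k a = (c a k)%:R].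

Let chan (l : 'I_M) := [seq (a, l) | a <- index_enum (channel G)].

Let uniq_chan l : uniq (chan l).
Proof. by rewrite map_inj_uniq ?index_enum_uniq// => a a' []. Qed.

Let eventE l b (bb : 'I_M -> bool) c : bb l = b ->
  event l b c = \bigcap_(i in [set` chan l])
    increments_event T h U xi bb i (c i.1).
Proof.
move=> <-; apply/seteqP; split => w /=.
  by move=> H _ /mapP[a _ ->] k; exact: H.
by move=> H k a; apply: (H (a, l)); apply/mapP; exists a; rewrite ?mem_index_enum.
Qed.

Lemma measurable_antithetic_event l b c : measurable (event l b c).
Proof.
rewrite (@eventE _ _ (fun=> b))//; apply: fin_bigcap_measurable; first exact: finite_seq.
by move=> i _; exact: measurable_increments_event.
Qed.

Lemma antithetic_event_law l b c :
  P (event l b c) = (\prod_a \prod_(k < K) pois (rate a * h) (c a k))%:E.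
Proof.
rewrite (@eventE _ _ (fun=> b))//.
rewrite (antithetic_increments_law (fun=> b) TE h0 inp (fun i => c i.1) (uniq_chan l)).
by rewrite big_map.
Qed.

(** As the pairs differ, a single choice of signs selects both trajectories. *)
Lemma antithetic_events_independent l b c l' b' c' : l != l' ->
  P (event l b c `&` event l' b' c') = (P (event l b c) * P (event l' b' c'))%E.
Proof.
move=> ll'; pose bb x := if x == l then b else b'.
have bbl : bb l = b by rewrite /bb eqxx.
have bbl' : bb l' = b' by rewrite /bb eq_sym (negbTE ll').
pose cc (i : channel G * 'I_M) := if i.2 == l then c i.1 else c' i.1.
have us : uniq (chan l ++ chan l').
  rewrite cat_uniq !uniq_chan andbT /=; apply/hasPn => _ /mapP[a _ ->].
  by apply/negP => /mapP[a' _ [_ /esym E]]; rewrite E eqxx in ll'.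
have -> : event l b c `&` event l' b' c' = \bigcap_(i in [set` chan l ++ chan l'])
    increments_event T h U xi bb i (cc i).
  rewrite (eventE _ bbl) (eventE _ bbl'); apply/seteqP; split => w /=.
    move=> [H H'] i /=; rewrite mem_cat => /orP[]ic k;
      [rewrite (H i ic)|rewrite (H' i ic)].
      by case/mapP: ic => a _ -> /=; rewrite /cc /= eqxx.
    by case/mapP: ic => a _ -> /=; rewrite /cc /= eq_sym (negbTE ll').
  move=> H; split => i /= ic k; rewrite (H i)/= ?mem_cat ?ic ?orbT//.
    by case/mapP: ic => a _ -> /=; rewrite /cc /= eqxx.
  by case/mapP: ic => a _ -> /=; rewrite /cc /= eq_sym (negbTE ll').
rewrite (antithetic_increments_law bb TE h0 inp cc us).
rewrite !antithetic_event_law -EFinM big_cat !big_map /=; congr (_ * _)%:E.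
  by apply: eq_bigr => a _; rewrite /cc /= eqxx.
by apply: eq_bigr => a _; rewrite /cc /= eq_sym (negbTE ll').
Qed.

Lemma nat_antithetic_increment l b w :
  nat_increments (antithetic_increment T h U xi l b w).
Proof. by move=> k a; apply: rpred_sum => p _; exact: rpred1. Qed.

End antithetic_pairs.

Section means.
Context d (Omega : measurableType d) (R : realType) (P : probability Omega R).
Implicit Types X Y : Omega -> R.

(** Carrying integrability along with the value gives linearity without side
    conditions. *)
Definition has_mean X (m : R) : Prop :=
  P.-integrable setT (EFin \o X) /\ 'E_P[X]%E = m%:E.

Lemma has_mean_cst c : has_mean (fun=> c) c.
Proof. by split; [exact: finite_measure_integrable_cst|exact: expectation_cst]. Qed.

Lemma has_meanD X Y m p : has_mean X m -> has_mean Y p ->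
  has_mean (fun w => X w + Y w) (m + p).
Proof.
move=> [iX EX] [iY EY]; split; first exact: (integrableD measurableT iX iY).
by rewrite (expectationD (X := X))/= ?EX ?EY//; exact/Lfun1_integrable.
Qed.

Lemma has_meanZ X m k : has_mean X m -> has_mean (fun w => k * X w) (k * m).
Proof.
move=> [iX EX]; split; first exact: (integrableZl measurableT k iX).
have := @expectationZl _ _ _ P X k; rewrite EX EFinM => <-; last exact/Lfun1_integrable.
by congr ('E_P[_])%E; apply/funext => w; rewrite mulrC.
Qed.

Lemma has_mean_sum (I : Type) (s : seq I) (X : I -> Omega -> R) (m : I -> R) :
  (forall i, has_mean (X i) (m i)) ->
  has_mean (fun w => \sum_(i <- s) X i w) (\sum_(i <- s) m i).
Proof.
move=> mX; elim: s => [|i s IH].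
  by rewrite big_nil; under eq_fun do rewrite big_nil; exact: has_mean_cst.
by rewrite big_cons; under eq_fun do rewrite big_cons; exact: has_meanD.
Qed.

End means.

Section mean_square_error.
Context d (Omega : measurableType d) (R : realType) (P : probability Omega R).
Context (M : nat) (Y : 'I_M * bool -> Omega -> R) (m q mu : R).
Hypotheses (M_gt0 : (0 < M)%N) (EY : forall i, has_mean P (Y i) m).
Hypothesis EY2 : forall i, has_mean P (fun w => Y i w ^+ 2) q.
Hypothesis EYY : forall i j, i.1 != j.1 -> has_mean P (fun w => Y i w * Y j w) (m ^+ 2).

Let L : R := (M * 2)%:R.

(** Products inside a pair are bounded by 2ab <= a^2 + b^2, products across
    pairs have mean m^2; each of the L summands shares its pair with exactly two,
    itself included, so the excess over (m - mu)^2 is at most 2 q / L. *)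
Lemma mean_square_error_le :
  ('E_P[fun w => (`| L^-1 * \sum_l (Y (l, true) w + Y (l, false) w) - mu | ^+ 2)%R]
   <= (2 * q / L + (m - mu) ^+ 2)%:E)%E.
Proof.
have L0 : 0 < L by rewrite ltr0n muln_gt0 M_gt0.
(* Upper bound of the product that is exact across pairs. *)
pose W i j w := if i.1 == j.1 then 2^-1 * (Y i w ^+ 2 + Y j w ^+ 2) else Y i w * Y j w.
have EW i j : has_mean P (W i j) (m ^+ 2 + (i.1 == j.1)%:R * (q - m ^+ 2)).
  rewrite /W; have [ij|ij] := eqVneq i.1 j.1.
    rewrite (_ : _ + _ = 2^-1 * (q + q)) /=; last by field.
    by apply: has_meanZ; exact: has_meanD.
  by rewrite mul0r addr0; exact: EYY.
pose V w := L^-1 ^+ 2 * (\sum_i \sum_j W i j w) +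
  - (2 * mu * L^-1) * (\sum_i Y i w) + mu ^+ 2.
have EV : has_mean P V (L^-1 ^+ 2 * (\sum_(i : 'I_M * bool) \sum_(j : 'I_M * bool)
      (m ^+ 2 + (i.1 == j.1)%:R * (q - m ^+ 2))) +
    - (2 * mu * L^-1) * (\sum_(i : 'I_M * bool) m) + mu ^+ 2).
  apply: has_meanD; last exact: has_mean_cst.
  apply: has_meanD; apply: has_meanZ; apply: has_mean_sum => i //.
  exact: has_mean_sum.
have cardL : \sum_(i : 'I_M * bool) m = L * m.
  by rewrite sumr_const card_prod card_ord card_bool [RHS]mulr_natl.
have sumW : \sum_(i : 'I_M * bool) \sum_(j : 'I_M * bool)
      (m ^+ 2 + (i.1 == j.1)%:R * (q - m ^+ 2)) = L * (L * m ^+ 2 + 2 * (q - m ^+ 2)).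
  rewrite (eq_bigr (fun=> L * m ^+ 2 + 2 * (q - m ^+ 2))) => [|i _].
    by rewrite sumr_const card_prod card_ord card_bool [RHS]mulr_natl.
  rewrite big_split /= sumr_const card_prod card_ord card_bool; congr (_ + _).
    by rewrite [RHS]mulr_natl.
  rewrite -mulr_suml; congr (_ * _).
  rewrite -(pair_bigA _ (fun l (b : bool) => (i.1 == l)%:R)) /=.
  rewrite (bigD1 i.1)//= big_bool eqxx big1 ?addr0// => l /negbTE li.
  by rewrite big_bool /= (eq_sym i.1) li mulr0n addr0.
have sumY w : \sum_l (Y (l, true) w + Y (l, false) w) = \sum_i Y i w.
  rewrite [RHS](eq_bigr (fun p => Y (p.1, p.2) w)) => [|[]//].
  rewrite -(pair_bigA _ (fun l b => Y (l, b) w)) /=.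
    by apply: eq_bigr => l _; rewrite big_bool.
have mY i : measurable_fun setT (Y i).
  by have [/integrableP[/measurable_EFinP]] := EY i.
have mV : measurable_fun setT V by have [/integrableP[/measurable_EFinP]] := EV.
have le w : `| L^-1 * \sum_l (Y (l, true) w + Y (l, false) w) - mu | ^+ 2 <= V w.
  rewrite real_normK ?num_real// sumY /V sqrrB exprMn lerD2r lerD//; last first.
    by rewrite -mulr_natl; lra.
  rewrite ler_wpM2l ?sqr_ge0// expr2 mulr_suml ler_sum// => i _.
  rewrite mulr_sumr ler_sum// => j _; rewrite /W; case: ifP => // _.
  by have := sqr_ge0 (Y i w - Y j w); nra.
apply: (@le_trans _ _ 'E_P[V]%E).
  apply: expectation_le => //.
  - apply: measurable_funX; apply: measurableT_comp => //.
    apply: measurable_funB => //; apply: measurable_funM => //.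
    by apply: measurable_sum => l; exact: measurable_funD.
  - by move=> w; rewrite (le_trans _ (le w))// exprn_ge0.
  - exact: aeW.
rewrite EV.2 lee_fin sumW cardL.
have -> : L^-1 ^+ 2 * (L * (L * m ^+ 2 + 2 * (q - m ^+ 2))) +
    - (2 * mu * L^-1) * (L * m) + mu ^+ 2 = 2 * q / L + (m - mu) ^+ 2 - 2 * m ^+ 2 / L.
  by move: L L0 => l l0; field; rewrite gt_eqF.
by rewrite gerBl mulr_ge0 ?invr_ge0 ?(ltW L0)// mulr_ge0 ?sqr_ge0.
Qed.
End mean_square_error.

(** * Uniform second moments *)

Section second_moments.
Context (R : realType) (n : nat) (G : network R n).
Context d (Omega : measurableType d) (P : probability Omega R).
Context (J : channel G -> R -> Omega -> nat) (g : 'cV[R]_n -> R).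
Hypothesis drv : independent_poisson_driver P J.

Lemma nat_driver_increment h w : 0 < h -> nat_increments (driver_increment J h w).
Proof. by move=> h0 k a; rewrite (driver_incrementE h0 drv) natr_nat. Qed.

Lemma measurable_driver_event h (K : nat) (c : channel G -> 'I_K -> nat) : 0 < h ->
  measurable [set w | forall (k : 'I_K) a, driver_increment J h w k a = (c a k)%:R].
Proof.
move=> h0.
have -> : [set w | forall (k : 'I_K) a, driver_increment J h w k a = (c a k)%:R] =
    \bigcap_(p in [set: 'I_K * channel G])
      (fun w => driver_increment J h w p.1 p.2) @^-1` [set (c p.2 p.1)%:R].
  by apply/seteqP; split => w /= H; [move=> p _; exact: H|move=> k a; exact: (H (k, a))].
apply: fin_bigcap_measurable => // p _; rewrite -[X in measurable X]setTI.
by apply: (all_moments_driver h0 drv p.1 p.2).1 => //; exact: measurable_set1.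
Qed.

Lemma measurable_scheme_fun (sch : scheme) h (K : nat) : 0 < h ->
  measurable_fun setT (fun w => g (scheme_run sch (driver_increment J h w) K)).
Proof.
move=> h0.
have mc : measurable_fun setT (fun w => increment_code K (driver_increment J h w)).
  apply: measurable_increment_code => [w|c]; first exact: nat_driver_increment.
  exact: measurable_driver_event.
pose f x := g (scheme_run sch (@increment_decode R n G K x) K).
have mf : measurable_fun setT f by [].
rewrite (_ : (fun w => _) =
    f \o (fun w => increment_code K (driver_increment J h w))).
  exact: measurableT_comp.
by apply/funext => w; rewrite /f /= scheme_run_code//; exact: nat_driver_increment.
Qed.

(** By polynomial growth, g(X^h)^2 is below a polynomial in the coordinates of
    X^h, which have moments of all orders. *)
Lemma second_moment_lty (sch : scheme) h (K : nat) : 0 < h -> poly_growth g ->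
  ('E_P[fun w => (g (scheme_run sch (driver_increment J h w) K) ^+ 2)%R] < +oo)%E.
Proof.
move=> h0 /poly_growthP[C C0 [s gC]].
pose x w := scheme_run sch (driver_increment J h w) K.
pose B w : R := 2 * C ^+ 2 * (1 + (\sum_j x w j 0 ^+ 2) ^+ s).
have mx j : all_moments P (fun w => x w j 0).
  exact: all_moments_scheme_run (all_moments_driver h0 drv) _ _.
have mB : all_moments P B.
  apply: all_momentsM; first exact: all_moments_cst.
  apply: all_momentsD; first exact: all_moments_cst.
  by apply: all_momentsX; apply: all_moments_sum => j; exact: all_momentsX.
have gB w : g (x w) ^+ 2 <= B w.
  have e0 : 0 <= enorm (x w) := enorm_ge0 _.
  have -> : B w = 2 * C ^+ 2 * (1 + (enorm (x w) ^+ s) ^+ 2).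
    rewrite /B -exprM mulnC exprM /enorm sqr_sqrtr// sumr_ge0// => j _.
    exact: sqr_ge0.
  rewrite -[leLHS]real_normK ?num_real//.
  apply: (@le_trans _ _ ((C * (1 + enorm (x w) ^+ s)) ^+ 2)).
    by rewrite lerXn2r ?nnegrE// mulr_ge0// addr_ge0// exprn_ge0.
  rewrite exprMn [in leRHS](mulrC 2) -[in leRHS]mulrA ler_wpM2l ?sqr_ge0//.
  by have := sqr_ge0 (1 - enorm (x w) ^+ s); nra.
have B0 w : 0 <= B w by rewrite (le_trans _ (gB w))// sqr_ge0.
apply: (@le_lt_trans _ _ 'E_P[B]%E).
  apply: expectation_le => //.
  - by apply: measurable_funX; exact: measurable_scheme_fun.
  - exact: mB.1.
  - by move=> w; exact: sqr_ge0.
  - exact: aeW.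
rewrite unlock; have /integrable_fin_num : P.-integrable setT (EFin \o B).
  exact: all_moments_integrable.
by move=> /(_ measurableT); rewrite ge0_fin_numE// integral_ge0// => w _; rewrite lee_fin.
Qed.

Definition second_moments_bounded (sch : scheme) (T S : R) : Prop :=
  forall h, 0 < h < 1 -> T / h \is a Num.nat ->
    ('E_P[fun w => (g (scheme_final sch T h (driver_increment J h w)) ^+ 2)%R] <= S%:E)%E.

(** For small h the weak order applied to g^2 compares the second moment with
    that of g(X(T)); the remaining step sizes T / k satisfy k < N, and the sum of
    their second moments dominates each of them. *)
Lemma second_moments_boundedP (X : R -> Omega -> 'cV[R]_n) (sch : scheme)
    (T beta : R) (r : nat) :
  0 < T -> ('E_P[fun w => (g (X T w) ^+ 2)%R] < +oo)%E ->
  0 < beta -> has_weak_order P J X sch T beta ->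
  r%:R = 2 * beta + 2 -> smooth_poly r g ->
  exists2 S : R, 0 <= S & second_moments_bounded sch T S.
Proof.
move=> T0 EX beta0 [r' r'E wo] rE sg.
have rr' : r = r' by apply/eqP; rewrite -(eqr_nat R) rE r'E.
subst r'.
have r0 : (0 < r)%N by rewrite -(ltr0n R) rE; lra.
have gg := smooth_poly_growth r0 sg.
have [C C0 [h1 h10 wC]] := wo _ (smooth_poly_sqr r0 sg).
pose E h := ('E_P[fun w => (g (scheme_final sch T h (driver_increment J h w)) ^+ 2)%R])%E.
pose EX2 := ('E_P[fun w => (g (X T w) ^+ 2)%R])%E.
have E0 h : (0 <= E h)%E by apply: expectation_ge0 => w; exact: sqr_ge0.
have Efin h : 0 < h -> E h \is a fin_num.
  by move=> h0; rewrite ge0_fin_numE//; exact: second_moment_lty.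
have EX0 : (0 <= EX2)%E.
  by apply: expectation_ge0 => w; exact: sqr_ge0.
have EXfin : EX2 \is a fin_num by rewrite ge0_fin_numE.
pose N := (Num.truncn (T / h1)).+1.
exists (fine EX2 + C + \sum_(k < N) fine (E (T / k%:R))).
  apply: addr_ge0; last by apply: sumr_ge0 => k _; exact: fine_ge0.
  by apply: addr_ge0; [exact: fine_ge0|exact: ltW].
move=> h /andP[h0 h01] Th; rewrite -/(E h).
rewrite -(fineK (Efin h h0)) lee_fin.
(* Steps below [h1] are covered by the weak order, the others by the sum. *)
have [hh1|h1h] := ltP h h1.
  have := wC h; rewrite h0 hh1 => /(_ isT Th).
  rewrite /weak_error_le -/(E h) -/EX2 -(fineK (Efin h h0)) -(fineK EXfin).
  rewrite -EFinB abse_EFin lee_fin.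
  move=> /(le_trans (ler_norm _)); rewrite lerBlDr => H; apply: (le_trans H).
  rewrite addrC; apply: (@le_trans _ _ (fine EX2 + C)); last first.
    by rewrite lerDl; apply: sumr_ge0 => k _; exact: fine_ge0.
  rewrite lerD2l ler_piMr ?(ltW C0)//.
  have : h `^ beta <= 1 `^ beta by rewrite ge0_ler_powR ?nnegrE ?ltW.
  by rewrite powR1.
pose k := Num.truncn (T / h).
have kE : k%:R = T / h by rewrite /k truncnK.
have hE : h = T / k%:R by rewrite kE invfM invrK mulrA divff ?mul1r// gt_eqF.
have kN : (k < N)%N.
  by rewrite /N ltnS /k le_truncn// ler_wpM2l ?(ltW T0)// lef_pV2 ?posrE.
rewrite {1}hE (bigD1 (Ordinal kN))//=.
rewrite addrCA lerDl addr_ge0//; last by apply: sumr_ge0 => i _; exact: fine_ge0.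
by apply: addr_ge0; [exact: fine_ge0|exact: ltW].
Qed.

End second_moments.

(** * The error of the estimator *)

Lemma RV_of_measurable d (Omega : measurableType d) (R : realType)
    (P : probability Omega R) (X : Omega -> nat) :
  measurable_fun setT X -> exists Y : {RV P >-> nat}, Y = X :> (Omega -> nat).
Proof.
move=> mX; pose c := isMeasurableFun.Build _ _ _ _ _ mX.
by exists (HB.pack X c : {RV P >-> nat}).
Qed.

Lemma integrable_of_sqr d (Omega : measurableType d) (R : realType)
    (P : probability Omega R) (Y : Omega -> R) :
  measurable_fun setT Y -> ('E_P[fun w => (Y w ^+ 2)%R] < +oo)%E ->
  P.-integrable setT (EFin \o Y) /\ P.-integrable setT (fun w => (Y w ^+ 2)%:E).
Proof.
move=> mY EY; have iY2 : P.-integrable setT (fun w => (Y w ^+ 2)%:E).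
  apply/integrableP; split; first by apply/measurable_EFinP; exact: measurable_funX.
  rewrite unlock in EY; under eq_integral do rewrite gee0_abs ?lee_fin ?sqr_ge0//.
  exact: EY.
split=> //; apply: (@le_integrable _ _ _ P _ measurableT _
  (fun w => (1 + Y w ^+ 2)%:E)).
- exact/measurable_EFinP.
- move=> w _; rewrite /= lee_fin [leRHS]ger0_norm ?addr_ge0 ?sqr_ge0//.
  rewrite -(real_normK (num_real (Y w))).
  by have := sqr_ge0 (1 - `|Y w|); have := normr_ge0 (Y w); nra.
- under eq_fun do rewrite EFinD; apply: integrableD => //.
  exact: finite_measure_integrable_cst.
Qed.

Section antithetic_mse.
Context (R : realType) (n : nat) (G : network R n).
Context d (Omega : measurableType d) (P : probability Omega R).
Context (J : channel G -> R -> Omega -> nat) (g : 'cV[R]_n -> R).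
Hypothesis drv : independent_poisson_driver P J.
Context (sch : scheme) (T h : R) (T0 : 0 < T) (h0 : 0 < h) (L : nat).
Hypotheses (Th : T / h \is a Num.nat) (L0 : (0 < L)%N) (Leven : ~~ odd L).
Context d' (Omega' : measurableType d') (P' : probability Omega' R).
Context (U : channel G -> 'I_(L./2) -> {RV P' >-> R}).
Context (xi : channel G -> 'I_(L./2) -> bool -> nat -> {RV P' >-> R}).
Hypothesis inp : antithetic_input T0 U xi.

Local Notation Yh w := (g (scheme_final sch T h (driver_increment J h w))).
Hypothesis EYh2 : ('E_P[fun w => (Yh w ^+ 2)%R] < +oo)%E.

Let K := Num.truncn (T / h).
Let TE : T = K%:R * h. Proof. by rewrite /K truncnK// divfK// gt_eqF. Qed.

Let v (i : 'I_(L./2) * bool) w := antithetic_increment T h U xi i.1 i.2 w.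
Let Y i w := g (scheme_final sch T h (v i w)).
Let f x := g (scheme_run sch (@increment_decode R n G K x) K).

Let nat_v i w : nat_increments (v i w).
Proof. exact: nat_antithetic_increment. Qed.

(** What is known about integer codes is transported to the estimator: summands
    have the law of g(X^h(T)), and those of different pairs are independent. *)
Lemma antithetic_mean_square_error (mu : R) :
  ('E_P'[fun w => (`|antithetic_estimator sch g T h U xi w - mu| ^+ 2)%R] <=
   (2 * fine ('E_P[fun w => (Yh w ^+ 2)%R])%E / L%:R +
    (fine ('E_P[fun w => Yh w])%E - mu) ^+ 2)%:E)%E.
Proof.
have [Z ZE] : exists Z : {RV P >-> nat},
    Z = (fun w => increment_code K (driver_increment J h w)) :> (_ -> _).
  apply: RV_of_measurable; apply: measurable_increment_code => [w|c].
    exact: (nat_driver_increment drv).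
  exact: (measurable_driver_event drv).
have /choice[Z' Z'E] : forall i, exists Z' : {RV P' >-> nat},
    Z' = (fun w => increment_code K (v i w)) :> (_ -> _).
  move=> i; apply: RV_of_measurable; apply: measurable_increment_code => // c.
  exact: measurable_antithetic_event.
have YhE w : Yh w = f (Z w).
  by rewrite /f ZE scheme_run_code//; exact: (nat_driver_increment drv).
have YE i w : Y i w = f (Z' i w) by rewrite /Y /f Z'E scheme_run_code.
have law i x : P' (Z' i @^-1` [set x]) = P (Z @^-1` [set x]).
  rewrite ZE Z'E; apply: increment_code_law => // [w|c].
    exact: (nat_driver_increment drv).
  rewrite (driver_increments_law h0 drv).
  exact: (antithetic_event_law TE h0 inp).
have EE (F : R -> R) i : ('E_P'[fun w => F (Y i w)] = 'E_P[fun w => F (Yh w)])%E.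
  rewrite (_ : (fun w => F (Y i w)) = (F \o f) \o Z' i); last first.
    by apply/funext => w; rewrite YE.
  rewrite (_ : (fun w => F (Yh w)) = (F \o f) \o Z); last first.
    by apply/funext => w; rewrite YhE.
  exact: expectation_eq_law.
have mY i : measurable_fun setT (Y i).
  rewrite (_ : Y i = f \o Z' i); last by apply/funext => w; rewrite YE.
  by apply: measurableT_comp.
have iY i : P'.-integrable setT (EFin \o Y i) /\
    P'.-integrable setT (fun w => (Y i w ^+ 2)%:E).
  by apply: integrable_of_sqr => //; rewrite (EE (fun y => y ^+ 2)).
have EY i : has_mean P' (Y i) (fine ('E_P[fun w => Yh w])%E).
  split; first exact: (iY i).1.
  rewrite -(EE id i) fineK// expectation_fin_num//.
  by apply/Lfun1_integrable; exact: (iY i).1.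
have EY2 i : has_mean P' (fun w => Y i w ^+ 2) (fine ('E_P[fun w => (Yh w ^+ 2)%R])%E).
  split; first exact: (iY i).2.
  rewrite -(EE (fun y => y ^+ 2) i) fineK// expectation_fin_num//.
  by apply/Lfun1_integrable; exact: (iY i).2.
have EYY i j : i.1 != j.1 ->
    has_mean P' (fun w => Y i w * Y j w) (fine ('E_P[fun w => Yh w])%E ^+ 2).
  move=> ij.
  have iYY : P'.-integrable setT (fun w => (Y i w * Y j w)%:E).
    apply: (@le_integrable _ _ _ P' _ measurableT _
      (fun w => (Y i w ^+ 2 + Y j w ^+ 2)%:E)).
    - by apply/measurable_EFinP; exact: measurable_funM.
    - move=> w _; rewrite /= lee_fin [leRHS]ger0_norm ?addr_ge0 ?sqr_ge0//.
      rewrite ler_norml; have := sqr_ge0 (Y i w - Y j w).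
      by have := sqr_ge0 (Y i w + Y j w); have := sqr_ge0 (Y i w);
        have := sqr_ge0 (Y j w) => *; apply/andP; split; nra.
    - exact: (integrableD measurableT (iY i).2 (iY j).2).
  split => //.
  have fE k : f \o Z' k = Y k by apply/funext => w; rewrite YE.
  rewrite (_ : (fun w => Y i w * Y j w) = (fun w => f (Z' i w) * f (Z' j w))); last first.
    by apply/funext => w; rewrite !YE.
  rewrite expectation_prod_independent ?fE.
  - by rewrite (EY i).2 (EY j).2 -EFinM expr2.
  - move=> x y; rewrite !Z'E; apply: increment_code_independent => // c c'.
    exact: (antithetic_events_independent TE h0 inp).
  - exact: (iY i).1.
  - exact: (iY j).1.
  - by apply: eq_integrable iYY => // w _; rewrite !YE.
have LE : (L./2 * 2)%N = L by rewrite muln2 halfK (negbTE Leven) subn0.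
have M0 : (0 < L./2)%N by move: L0; rewrite -[X in (0 < X)%N]LE muln_gt0 andbT.
have := @mean_square_error_le _ _ _ P' _ _ _ _ mu M0 EY EY2 EYY.
by rewrite LE.
Qed.

End antithetic_mse.

Theorem theorem1 (R : realType) (n : nat) (G : network R n)
    (d : measure_display) (Omega : measurableType d) (P : probability Omega R)
    (J : channel G -> R -> Omega -> nat) (X : R -> Omega -> 'cV[R]_n)
    (T : R) (T_gt0 : 0 < T) (g : 'cV[R]_n -> R) :
  independent_poisson_driver P J ->
  jump_sde_solution P J X ->
  (exists (C : R) (s : nat), [/\ 0 < C, (0 < s)%N &
    forall x, g x <= C * (1 + enorm x ^+ s)]) ->
  ('E_P[fun w => (g (X T w) ^+ 2)%R] < +oo)%E ->
  exists2 sigma2 : R, 0 <= sigma2 &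
    forall (sch : scheme) (beta : R) (r : nat) (C : R),
      0 < beta -> has_weak_order P J X sch T beta ->
      r%:R = 2 * beta + 2 -> smooth_poly r g ->
      0 < C -> weak_order_constant P J X sch T g beta C ->
    forall (h : R) (L : nat),
      0 < h < 1 -> T / h \is a Num.nat ->
      weak_error_le P J X sch T g beta C h ->
      (0 < L)%N -> ~~ odd L ->
    forall (d' : measure_display) (Omega' : measurableType d')
      (P' : probability Omega' R)
      (U : channel G -> 'I_(L./2) -> {RV P' >-> R})
      (xi : channel G -> 'I_(L./2) -> bool -> nat -> {RV P' >-> R}),
      antithetic_input T_gt0 U xi ->
      (rmse P' (antithetic_estimator sch g T h U xi)
            (fine 'E_P[fun w => g (X T w)])
       <= (Num.sqrt (sigma2 / L%:R + C ^+ 2 * h `^ (2 * beta)))%:E)%E.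
Proof.
move=> drv _ _ EX2.
(* A bound on the second moments of each scheme, chosen before beta is known:
   existence is what a weak order provides, the value does not depend on it. *)
have /choice[S SP] : forall sch, exists S : R, 0 <= S /\
    ((exists2 S', 0 <= S' & second_moments_bounded P J g sch T S') ->
     second_moments_bounded P J g sch T S).
  move=> sch.
  have [[S S0 SP]|N] := pselect
    (exists2 S', 0 <= S' & second_moments_bounded P J g sch T S').
  - by exists S.
  - by exists 0.
exists (2 * (S Euler + S Taylor)).
  by rewrite mulr_ge0// addr_ge0//; exact: (SP _).1.
move=> sch beta r C beta0 wo rE sg C0 _ h L /andP[h0 h1] Th werr L0 Lev
  d' Omega' P' U xi inp.
have bS := (SP sch).2 (second_moments_boundedP drv T_gt0 EX2 beta0 wo rE sg).
have {}bS : ('E_P[fun w => (g (scheme_final sch T h (driver_increment J h w)) ^+ 2)%R]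
    <= (S sch)%:E)%E by apply: bS => //; rewrite h0.
have SS : S sch <= S Euler + S Taylor.
  by case: (sch); rewrite ?lerDl ?lerDr; exact: (SP _).1.
have E2fin := le_lt_trans bS (ltry _).
have := antithetic_mean_square_error drv h0 Th L0 Lev inp E2fin
  (fine ('E_P[fun w => g (X T w)])%E).
set mu := fine _; set q := fine _; set m := fine _ => mse.
have qS : q <= S sch.
  rewrite -lee_fin /q fineK// ge0_fin_numE//.
  by apply: expectation_ge0 => w; exact: sqr_ge0.
(* The weak error bound is an inequality in \bar R that forces both means finite. *)
have bias : `|m - mu| <= C * h `^ beta.
  move: werr; rewrite /weak_error_le /m /mu.
  case: ('E_P[_])%E => [a||]; case: ('E_P[_])%E => [b||] //=.
have bias2 : (m - mu) ^+ 2 <= C ^+ 2 * h `^ (2 * beta).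
  rewrite (mulrC 2) powRrM -[(_ `^ _) `^ 2]/((h `^ beta) `^ 2%:R) powR_mulrn ?powR_ge0//.
  rewrite -exprMn -real_normK ?num_real// lerXn2r ?nnegrE//.
  by rewrite mulr_ge0 ?powR_ge0// ltW.
set B := _ + _.
have msele :
    ('E_P'[fun w => (`|antithetic_estimator sch g T h U xi w - mu| ^+ 2)%R]
     <= B%:E)%E.
  apply: (le_trans mse); rewrite lee_fin lerD// ler_wpM2r ?invr_ge0//.
  by rewrite ler_wpM2l// (le_trans qS).
have B0 : 0 <= B.
  apply: addr_ge0; last by apply: mulr_ge0; [exact: sqr_ge0|exact: powR_ge0].
  by rewrite divr_ge0// mulr_ge0// addr_ge0//; exact: (SP _).1.
rewrite /rmse -powR12_sqrt// -poweR_EFin.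
apply: gt0_ler_poweR => //.
- by rewrite in_itv /= leey andbT; apply: expectation_ge0 => w; exact: exprn_ge0.
- by rewrite in_itv /= leey andbT lee_fin.
Qed.
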